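(* Let $G$ be any one of the following bounded automata groups: (i) the first Grigorchuk group, acting on the binary rooted tree $\{0,1\}^*$; (ii) the Hanoi tower group on three pegs, acting on the ternary rooted tree $\{0,1,2\}^*$; (iii) the Basilica group, acting on the binary rooted tree $\{0,1\}^*$. Let $C$ be the corresponding alphabet ($\{0,1\}$ in cases (i) and (iii), $\{0,1,2\}$ in case (ii)), and let $X$ be a finite symmetric generating set of $G$. Then for every infinite ray $\eta\in C^\omega$ the language $\mathrm{WP}(G,X,\mathrm{Stab}(\eta))$ is not context-free.
   Context: For a finite alphabet $C$ with $d\geq 2$ letters, the $d$-regular rooted tree has vertex set $C^*$ (finite words), and its infinite rays from the root are the infinite words in $C^\omega$. Automorphisms of the tree act on the right on $C^*$ and, by continuity (by the same recursive formulas), on $C^\omega$. For an automorphism $\alpha$ and a vertex $v\in C^*$, the section of $\alpha$ at $v$ is the automorphism $\alpha_v$ with $(vw)\cdot\alpha=(v\cdot\alpha)(w\cdot\alpha_v)$ for all $w\in C^*$. The automorphism $\alpha$ is a bounded automaton automorphism if it has only finitely many distinct sections and there is a constant $N$ such that, for every positive integer $k$, fewer than $N$ vertices $v$ of length $k$ have $\alpha_v\neq 1$. A bounded automata group is a group consisting of bounded automaton automorphisms. For $\eta\in C^\omega$, $\mathrm{Stab}(\eta)=\{g\in G:\eta\cdot g=\eta\}$. For $w\in X^*$, $\overline w\in G$ is the product of the letters of $w$, and for a subgroup $H\le G$, $\mathrm{WP}(G,X,H)=\{w\in X^*:\overline w\in H\}$. The groups are generated by the following automorphisms, where $w$ is an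 arbitrary word. First Grigorchuk group, generated by $a,b,c,d$ on $\{0,1\}^*$: $(0w)\cdot a=1w$, $(1w)\cdot a=0w$; $(0w)\cdot b=0(w\cdot a)$, $(1w)\cdot b=1(w\cdot c)$; $(0w)\cdot c=0(w\cdot a)$, $(1w)\cdot c=1(w\cdot d)$; $(0w)\cdot d=0w$, $(1w)\cdot d=1(w\cdot b)$. Hanoi tower group on three pegs, generated by $a,b,c$ on $\{0,1,2\}^*$: $(0w)\cdot a=1w$, $(1w)\cdot a=0w$, $(2w)\cdot a=2(w\cdot a)$; $(0w)\cdot b=2w$, $(2w)\cdot b=0w$, $(1w)\cdot b=1(w\cdot b)$; $(1w)\cdot c=2w$, $(2w)\cdot c=1w$, $(0w)\cdot c=0(w\cdot c)$. Basilica group, generated by $a,b$ on $\{0,1\}^*$: $(0w)\cdot a=0(w\cdot b)$, $(1w)\cdot a=1w$; $(0w)\cdot b=1(w\cdot a)$, $(1w)\cdot b=0w$. *)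

(* Defs.v *)
From HB Require Import structures.
From mathcomp Require Import all_boot all_algebra finmap.
From mathcomp Require Import boolp classical_sets.
Set Implicit Arguments.
Unset Strict Implicit.
Unset Printing Implicit Defensive.

Import GRing.Theory.
Local Open Scope classical_set_scope.
Local Open Scope ring_scope.

(** Automorphisms of the regular rooted tree with vertex set [seq C]: the
    children of a vertex [v] are the [rcons v x]. *)

Record tree_aut (C : finType) := TreeAut {
  aut_fun :> seq C -> seq C;
  aut_inv : seq C -> seq C;
  aut_funK : cancel aut_fun aut_inv;
  aut_invK : cancel aut_inv aut_fun;
  aut_root : aut_fun [::] = [::];
  aut_child : forall v x, exists y, aut_fun (rcons v x) = rcons (aut_fun v) y
}.

Section TreeAutGroup.
Variable C : finType.
Implicit Types g h : tree_aut C.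

Lemma tree_autP g h : g =1 h -> g = h.
Proof.
case: g h => [f f' fK f'K f0 fS] [k k' kK k'K k0 kS] /= /funext efk.
subst k; have e' : f' = k' by apply/funext => v; rewrite -[in LHS](k'K v) fK.
subst k'; rewrite (Prop_irrelevance fK kK) (Prop_irrelevance f'K k'K).
by rewrite (Prop_irrelevance f0 k0) (Prop_irrelevance fS kS).
Qed.

Definition tree_aut_one : tree_aut C :=
  @TreeAut C id id (frefl _) (frefl _) erefl
    (fun v x => ex_intro _ x erefl).

Lemma tree_aut_inv_root g : aut_inv g [::] = [::].
Proof. by rewrite -[in LHS](aut_root g) aut_funK. Qed.

Lemma tree_aut_inv_child g v x :
  exists y, aut_inv g (rcons v x) = rcons (aut_inv g v) y.
Proof.
have := aut_invK g (rcons v x).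
case: (lastP (aut_inv g (rcons v x))) => [|u y].
  by rewrite aut_root => /(congr1 size); rewrite size_rcons.
have [z ->] := aut_child g u y => /rcons_inj[<- _].
by exists y; rewrite aut_funK.
Qed.

Definition tree_aut_inv g : tree_aut C :=
  @TreeAut C (aut_inv g) g (aut_invK g) (aut_funK g)
    (tree_aut_inv_root g) (tree_aut_inv_child g).

Lemma tree_aut_mul_root g h : h (g [::]) = [::].
Proof. by rewrite !aut_root. Qed.

Lemma tree_aut_mul_child g h v x :
  exists y, h (g (rcons v x)) = rcons (h (g v)) y.
Proof. by have [y ->] := aut_child g v x; apply: aut_child. Qed.

(* Automorphisms act on the right: [g * h] is [g] followed by [h]. *)
Definition tree_aut_mul g h : tree_aut C :=
  @TreeAut C (h \o g) (aut_inv g \o aut_inv h)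
    (can_comp (aut_funK h) (aut_funK g)) (can_comp (aut_invK g) (aut_invK h))
    (tree_aut_mul_root g h) (tree_aut_mul_child g h).

Fact tree_aut_mulA : associative tree_aut_mul.
Proof. by move=> f g h; apply: tree_autP. Qed.

Fact tree_aut_mul1 : left_id tree_aut_one tree_aut_mul.
Proof. by move=> g; apply: tree_autP. Qed.

Fact tree_aut_mulr1 : right_id tree_aut_one tree_aut_mul.
Proof. by move=> g; apply: tree_autP. Qed.

Fact tree_aut_mulV : left_inverse tree_aut_one tree_aut_inv tree_aut_mul.
Proof. by move=> g; apply: tree_autP => v /=; rewrite aut_invK. Qed.

Fact tree_aut_mulrV : right_inverse tree_aut_one tree_aut_inv tree_aut_mul.
Proof. by move=> g; apply: tree_autP => v /=; rewrite aut_funK. Qed.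

HB.instance Definition _ := gen_eqMixin (tree_aut C).
HB.instance Definition _ := gen_choiceMixin (tree_aut C).
HB.instance Definition _ := isGroup.Build (tree_aut C)
  tree_aut_mulA tree_aut_mul1 tree_aut_mulr1 tree_aut_mulV tree_aut_mulrV.

(* The continuous extension of [g] to infinite words: [ray_act_prefix] says
   that it maps the prefixes of [eta] to those of [ray_act eta g].  The default
   value [eta n] of [nth] is never used. *)
Definition ray_act (eta : nat -> C) g : nat -> C :=
  fun n => nth (eta n) (g (mkseq eta n.+1)) n.

Lemma size_tree_aut g v : size (g v) = size v.
Proof.
elim/last_ind: v => [|v x IHv]; first by rewrite aut_root.
by have [y ->] := aut_child g v x; rewrite !size_rcons IHv.
Qed.

Lemma ray_act_prefix eta g n : mkseq (ray_act eta g) n = g (mkseq eta n).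
Proof.
elim: n => [|n IHn]; first by rewrite aut_root.
have eS (f : nat -> C) : mkseq f n.+1 = rcons (mkseq f n) (f n).
  by rewrite /mkseq -[n.+1]addn1 iotaD map_cat /= cats1.
rewrite eS IHn /ray_act [in RHS]eS [in X in rcons _ X]eS.
have [y ->] := aut_child g (mkseq eta n) (eta n).
by rewrite nth_rcons size_tree_aut size_mkseq ltnn eqxx.
Qed.

Definition Stab (G : set (tree_aut C)) (eta : nat -> C) : set (tree_aut C) :=
  [set g | G g /\ ray_act eta g = eta].

End TreeAutGroup.

Definition subgroup_gen (T : groupType) (S : set T) : set T :=
  smallest (fun H : set T => group_closed (mem H)) S.

Definition symmetric_generating_set (T : groupType) (G : set T)
    (X : {fset T}) : Prop :=
  (forall x : T, x \in X -> x^-1%g \in X) /\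
  subgroup_gen [set` X] = G.

Definition WP (T : groupType) (X : {fset T}) (H : set T) : set (seq X) :=
  [set w | H (\prod_(x <- w) fsval x)%g].
Arguments WP {T} X H.

(* In sentential forms, [inl] marks nonterminals and [inr] terminals. *)
Record cfg (A : finType) := Cfg {
  nonterminal : finType;
  start : nonterminal;
  rules : seq (nonterminal * seq (nonterminal + A))
}.

Inductive derives (A : finType) (Gr : cfg A) :
    seq (nonterminal Gr + A) -> seq (nonterminal Gr + A) -> Prop :=
| derives_refl s : derives s s
| derives_step N r u v t :
    (N, r) \in rules Gr -> derives (u ++ r ++ v) t ->
    derives (u ++ inl N :: v) t.

Definition cfg_language (A : finType) (Gr : cfg A) : set (seq A) :=
  [set w | derives [:: inl (start Gr)] (map inr w)].

Definition context_free (A : finType) (L : set (seq A)) : Prop :=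
  exists Gr : cfg A, L = cfg_language Gr.

(* The ring structure of ['I_n] serves only to write its elements as numerals. *)

Definition grig_a_fun (w : seq 'I_2) : seq 'I_2 :=
  if w is x :: w' then
    if x == 0 then 1 :: w' else 0 :: w'
  else [::].

Fixpoint grig_b_fun (w : seq 'I_2) : seq 'I_2 :=
  if w is x :: w' then
    if x == 0 then 0 :: grig_a_fun w' else 1 :: grig_c_fun w'
  else [::]
with grig_c_fun (w : seq 'I_2) : seq 'I_2 :=
  if w is x :: w' then
    if x == 0 then 0 :: grig_a_fun w' else 1 :: grig_d_fun w'
  else [::]
with grig_d_fun (w : seq 'I_2) : seq 'I_2 :=
  if w is x :: w' then
    if x == 0 then 0 :: w' else 1 :: grig_b_fun w'
  else [::].

Fixpoint hanoi_a_fun (w : seq 'I_3) : seq 'I_3 :=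
  if w is x :: w' then
    if x == 0 then 1 :: w' else if x == 1 then 0 :: w' else 2 :: hanoi_a_fun w'
  else [::].

Fixpoint hanoi_b_fun (w : seq 'I_3) : seq 'I_3 :=
  if w is x :: w' then
    if x == 0 then 2 :: w' else if x == 2 then 0 :: w' else 1 :: hanoi_b_fun w'
  else [::].

Fixpoint hanoi_c_fun (w : seq 'I_3) : seq 'I_3 :=
  if w is x :: w' then
    if x == 1 then 2 :: w' else if x == 2 then 1 :: w' else 0 :: hanoi_c_fun w'
  else [::].

Fixpoint basilica_a_fun (w : seq 'I_2) : seq 'I_2 :=
  if w is x :: w' then
    if x == 0 then 0 :: basilica_b_fun w' else 1 :: w'
  else [::]
with basilica_b_fun (w : seq 'I_2) : seq 'I_2 :=
  if w is x :: w' then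
    if x == 0 then 1 :: basilica_a_fun w' else 0 :: w'
  else [::].

Fixpoint basilica_a_inv (w : seq 'I_2) : seq 'I_2 :=
  if w is x :: w' then
    if x == 0 then 0 :: basilica_b_inv w' else 1 :: w'
  else [::]
with basilica_b_inv (w : seq 'I_2) : seq 'I_2 :=
  if w is x :: w' then
    if x == 1 then 0 :: basilica_a_inv w' else 1 :: w'
  else [::].

Lemma ord2_cases (x : 'I_2) : x = 0 \/ x = 1.
Proof. by case: x => [[|[|//]] p]; [left|right]; apply/val_inj. Qed.

Lemma ord3_cases (x : 'I_3) : [\/ x = 0, x = 1 | x = 2].
Proof.
case: x => [[|[|[|//]]] p]; [constructor 1|constructor 2|constructor 3];
  exact/val_inj.
Qed.

Lemma grig_aK : involutive grig_a_fun.
Proof. by case=> //= x w; case: (ord2_cases x) => ->. Qed.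

Lemma grig_bcdK w :
  [/\ grig_b_fun (grig_b_fun w) = w, grig_c_fun (grig_c_fun w) = w
    & grig_d_fun (grig_d_fun w) = w].
Proof.
elim: w => // x w [IHb IHc IHd].
by case: (ord2_cases x) => ->; split; rewrite /= ?grig_aK ?IHb ?IHc ?IHd.
Qed.

Lemma grig_bK : involutive grig_b_fun.
Proof. by move=> w; case: (grig_bcdK w). Qed.

Lemma grig_cK : involutive grig_c_fun.
Proof. by move=> w; case: (grig_bcdK w). Qed.

Lemma grig_dK : involutive grig_d_fun.
Proof. by move=> w; case: (grig_bcdK w). Qed.

Lemma grig_a_child v x : exists y, grig_a_fun (rcons v x) = rcons (grig_a_fun v) y.
Proof.
case: v => [|z v] /=; last by case: ifP => _; exists x.
by case: ifP => _; [exists 1|exists 0].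
Qed.

Lemma grig_bcd_child v x :
  [/\ exists y, grig_b_fun (rcons v x) = rcons (grig_b_fun v) y,
      exists y, grig_c_fun (rcons v x) = rcons (grig_c_fun v) y
    & exists y, grig_d_fun (rcons v x) = rcons (grig_d_fun v) y].
Proof.
elim: v => [|z v [[b IHb] [c IHc] [d IHd]]] /=.
  by split; case: ifP => _; by [exists 0|exists 1].
have [a IHa] := grig_a_child v x.
by rewrite IHa IHb IHc IHd; split; case: ifP => _; eexists.
Qed.

Definition grig_a : tree_aut 'I_2 :=
  TreeAut grig_aK grig_aK erefl grig_a_child.

Definition grig_b : tree_aut 'I_2 :=
  TreeAut grig_bK grig_bK erefl
    (fun v x => let: And3 h _ _ := grig_bcd_child v x in h).

Definition grig_c : tree_aut 'I_2 :=
  TreeAut grig_cK grig_cK erefl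
    (fun v x => let: And3 _ h _ := grig_bcd_child v x in h).

Definition grig_d : tree_aut 'I_2 :=
  TreeAut grig_dK grig_dK erefl
    (fun v x => let: And3 _ _ h := grig_bcd_child v x in h).

Definition grigorchuk_group : set (tree_aut 'I_2) :=
  subgroup_gen [set grig_a; grig_b; grig_c; grig_d].

Lemma hanoi_aK : involutive hanoi_a_fun.
Proof. by elim=> //= x w IHw; case: (ord3_cases x) => -> //=; rewrite IHw. Qed.

Lemma hanoi_bK : involutive hanoi_b_fun.
Proof. by elim=> //= x w IHw; case: (ord3_cases x) => -> //=; rewrite IHw. Qed.

Lemma hanoi_cK : involutive hanoi_c_fun.
Proof. by elim=> //= x w IHw; case: (ord3_cases x) => -> //=; rewrite IHw. Qed.

Lemma hanoi_a_child v x :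
  exists y, hanoi_a_fun (rcons v x) = rcons (hanoi_a_fun v) y.
Proof.
elim: v => [|z v [y IHv]] /=; last by rewrite IHv; do 2?case: ifP => _; eexists.
by exists (head 0 (hanoi_a_fun [:: x])) => /=; do 2?case: ifP.
Qed.

Lemma hanoi_b_child v x :
  exists y, hanoi_b_fun (rcons v x) = rcons (hanoi_b_fun v) y.
Proof.
elim: v => [|z v [y IHv]] /=; last by rewrite IHv; do 2?case: ifP => _; eexists.
by exists (head 0 (hanoi_b_fun [:: x])) => /=; do 2?case: ifP.
Qed.

Lemma hanoi_c_child v x :
  exists y, hanoi_c_fun (rcons v x) = rcons (hanoi_c_fun v) y.
Proof.
elim: v => [|z v [y IHv]] /=; last by rewrite IHv; do 2?case: ifP => _; eexists.
by exists (head 0 (hanoi_c_fun [:: x])) => /=; do 2?case: ifP.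
Qed.

Definition hanoi_a : tree_aut 'I_3 :=
  TreeAut hanoi_aK hanoi_aK erefl hanoi_a_child.

Definition hanoi_b : tree_aut 'I_3 :=
  TreeAut hanoi_bK hanoi_bK erefl hanoi_b_child.

Definition hanoi_c : tree_aut 'I_3 :=
  TreeAut hanoi_cK hanoi_cK erefl hanoi_c_child.

Definition hanoi_group : set (tree_aut 'I_3) :=
  subgroup_gen [set hanoi_a; hanoi_b; hanoi_c].

Lemma basilica_funK w :
  basilica_a_inv (basilica_a_fun w) = w /\
  basilica_b_inv (basilica_b_fun w) = w.
Proof.
elim: w => // x w [IHa IHb].
by case: (ord2_cases x) => ->; split; rewrite /= ?IHa ?IHb.
Qed.

Lemma basilica_invK w :
  basilica_a_fun (basilica_a_inv w) = w /\
  basilica_b_fun (basilica_b_inv w) = w.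
Proof.
elim: w => // x w [IHa IHb].
by case: (ord2_cases x) => ->; split; rewrite /= ?IHa ?IHb.
Qed.

Lemma basilica_child v x :
  (exists y, basilica_a_fun (rcons v x) = rcons (basilica_a_fun v) y) /\
  (exists y, basilica_b_fun (rcons v x) = rcons (basilica_b_fun v) y).
Proof.
elim: v => [|z v [[a IHa] [b IHb]]] /=.
  by split; case: ifP => _; by [exists 0|exists 1].
by rewrite IHa IHb; split; case: ifP => _; eexists.
Qed.

Definition basilica_a : tree_aut 'I_2 :=
  TreeAut (fun w => (basilica_funK w).1) (fun w => (basilica_invK w).1) erefl
    (fun v x => (basilica_child v x).1).

Definition basilica_b : tree_aut 'I_2 :=
  TreeAut (fun w => (basilica_funK w).2) (fun w => (basilica_invK w).2) erefl
    (fun v x => (basilica_child v x).2).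

Definition basilica_group : set (tree_aut 'I_2) :=
  subgroup_gen [set basilica_a; basilica_b].

(* Main.v *)
Require Import Defs.
From mathcomp Require Import all_boot all_order all_algebra finmap zify.
From mathcomp Require Import boolp classical_sets.
Set Implicit Arguments.
Unset Strict Implicit.
Unset Printing Implicit Defensive.
Import Order.TTheory GRing.Theory Num.Theory.

(** The words of [WP X (Stab G eta)] are the loops at [eta] in the Schreier graph
    of [eta].  If a context-free grammar generates them, the words derived from a
    symbol in a fixed context all lead to the same vertex, so each may be
    replaced by a sample word of bounded length.  Hence every loop is filled by
    loops of bounded length, in the sense of homology.  The Schreier graphs of
    the Hanoi and Basilica groups contain arbitrarily long cycles onto which they
    retract by maps that are Lipschitz with a uniform constant, and such a cycle
    cannot be filled.

    The Schreier graphs of the Grigorchuk group are quasi-lines.  If u v t is a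
    loop, where u goes straight to p, v is a loop at p beyond u, and t goes back,
    then the lowest node of the parse tree that contains v spans only boundedly
    many letters of u and t.  By the pigeonhole principle two such v can be
    exchanged.  But the labels of the line are those of a ruler sequence: from
    the vertices p with prefix 1^n 0 1 0, walk to the vertex with prefix
    1^n 1 1 0, read there the generator that fixes it and walk back; for m > n
    the n-th of these loops is not a loop at the m-th vertex. *)

(** * Parse trees *)

Lemma cat_eq_cat (T : Type) (x y u v : seq T) : x ++ y = u ++ v ->
  (exists c, u = x ++ c /\ y = c ++ v) \/ (exists c, x = u ++ c /\ v = c ++ y).
Proof.
elim: x u => [|a x IHx] [|b u] /=; try by [left; exists [::]|left; eexists].
  by move=> <-; right; exists (a :: x).
by case=> <- /IHx [] [c [-> ->]]; [left|right]; exists c.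
Qed.

Lemma pigeonhole (T : finType) (f : nat -> T) :
  exists i j : nat, (i < j)%N /\ f i = f j.
Proof.
have /injectivePn[i [j ij fij]] : ~~ injectiveb (fun i : 'I_#|T|.+1 => f i).
  by apply/negP => /injectiveP /leq_card; rewrite card_ord ltnn.
by move: ij; rewrite -val_eqE neq_ltn => /orP[ij|ij]; do 2?eexists; eauto.
Qed.

Section Yields.
Variables (A : finType) (Gr : cfg A).
Implicit Types (s r : seq (nonterminal Gr + A)) (u v w t y : seq A).

(** Big-step form of [derives]: its proofs are parse forests, over which the inductions below
    run. *)
Inductive yields : seq (nonterminal Gr + A) -> seq A -> Prop :=
| yields_nil : yields [::] [::]
| yields_ter a s w : yields s w -> yields (inr a :: s) (a :: w)
| yields_nt N r s w1 w2 : (N, r) \in rules Gr ->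
    yields r w1 -> yields s w2 -> yields (inl N :: s) (w1 ++ w2).

Lemma yields_cat s1 s2 w1 w2 :
  yields s1 w1 -> yields s2 w2 -> yields (s1 ++ s2) (w1 ++ w2).
Proof.
move=> y1 y2; elim: y1 => [|a s w _ IH|N r s v1 v2 Nr yr _ _ IH] //=.
  exact: yields_ter.
by rewrite -catA; apply: yields_nt yr IH.
Qed.

Lemma yields_catP s1 s2 w : yields (s1 ++ s2) w ->
  exists w1 w2, [/\ w = w1 ++ w2, yields s1 w1 & yields s2 w2].
Proof.
elim: s1 w => [|x s1 IH] w /=; first by exists [::], w; split => //; apply: yields_nil.
move E : (x :: _) => s ys; case: s w / ys E => //.
  by move=> a s w ys [-> E]; move: ys; rewrite -E => /IH[w1 [w2 [-> y1 y2]]];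
    exists (a :: w1), w2; split => //; apply: yields_ter.
move=> N r s v1 v2 Nr yr ys [-> E]; move: ys; rewrite -E.
move=> /IH[w1 [w2 [-> y1 y2]]].
by exists (v1 ++ w1), w2; rewrite catA; split => //; apply: yields_nt yr y1.
Qed.

Lemma yields_map_inr w : yields (map inr w) w.
Proof. by elim: w => [|a w IHw] /=; [exact: yields_nil|exact: yields_ter]. Qed.

Lemma yields_rule N r w : (N, r) \in rules Gr -> yields r w -> yields [:: inl N] w.
Proof. by move=> Nr yr; rewrite -[w]cats0; apply: yields_nt yr yields_nil. Qed.

Lemma derives_yields s w : derives s (map inr w) -> yields s w.
Proof.
move E : (map inr w) => t d.
elim: d E => [{}s <-|N r u v {}t Nr _ IH /IH]; first exact: yields_map_inr.
move=> /yields_catP[w1 [w' [-> yu /yields_catP[w2 [w3 [-> yr yv]]]]]].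
by apply: yields_cat => //; apply: yields_nt yr yv.
Qed.

Lemma derives_trans s1 s2 s3 : derives s1 s2 -> derives s2 s3 -> derives s1 s3.
Proof. by elim=> // N r u v t Nr _ IH /IH; apply: derives_step. Qed.

Lemma derives_ctx (x y s t : seq (nonterminal Gr + A)) : derives s t -> derives (x ++ s ++ y) (x ++ t ++ y).
Proof.
elim=> [{}s|N r u v {}t Nr _ IH]; first by left.
rewrite -catA cat_cons catA; apply: (derives_step Nr).
by rewrite -catA; move: IH; rewrite -!catA.
Qed.

Lemma yields_derives s w : yields s w -> derives s (map inr w).
Proof.
elim=> [|a {}s {}w _ IH|N r {}s w1 w2 Nr _ IHr _ IHs]; first by left.
  by have := derives_ctx [:: inr a] [::] IH; rewrite !cats0.
apply: (@derives_step _ _ N r [::] s) => //=; rewrite map_cat.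
have /= := derives_ctx [::] s IHr; move/derives_trans; apply.
by have := derives_ctx (map inr w1) [::] IHs; rewrite !cats0.
Qed.

Lemma cfg_languageE : cfg_language Gr = [set w | yields [:: inl (start Gr)] w]%classic.
Proof.
apply/seteqP; split=> w; [exact: derives_yields|exact: yields_derives].
Qed.

(** A semantic notion of context, which does not require a derivation of the sentential form around
    [s]. *)
Definition context (L : set (seq A)) s u t :=
  forall y, yields s y -> L (u ++ y ++ t).

Lemma context_cat L s1 s2 u t y1 y2 : context L (s1 ++ s2) u t ->
  yields s1 y1 -> yields s2 y2 ->
  context L s1 u (y2 ++ t) /\ context L s2 (u ++ y1) t.
Proof.
move=> ctx h1 h2; split=> y hy.
  by have := ctx _ (yields_cat hy h2); rewrite -!catA.
by have := ctx _ (yields_cat h1 hy); rewrite -!catA.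
Qed.

Lemma context_rule L N r u t :
  (N, r) \in rules Gr -> context L [:: inl N] u t -> context L r u t.
Proof. by move=> Nr ctx y hy; apply/ctx/(yields_rule Nr). Qed.

(* The second alternative records the lowest node [N] of the parse tree whose
   yield contains the whole of [v]. *)
Lemma yields_split s w : yields s w -> forall u v t, w = u ++ v ++ t ->
  (exists s1 s2 v1 v2, [/\ s = s1 ++ s2, v = v1 ++ v2,
     yields s1 (u ++ v1) & yields s2 (v2 ++ t)]) \/
  (exists N s1 s2 u1 u2 t1 t2 v1 v2,
     [/\ (N, s1 ++ s2) \in rules Gr, [/\ u = u1 ++ u2, v = v1 ++ v2 & t = t2 ++ t1],
       yields s1 (u2 ++ v1), yields s2 (v2 ++ t2) &
       forall L u0 t0, context L s u0 t0 ->
         context L [:: inl N] (u0 ++ u1) (t1 ++ t0)]).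
Proof.
elim=> [|a {}s {}w ys IH|N r {}s w1 w2 Nr yr IHr ys IHs] u v t.
- case: u => //; case: v => //; case: t => // _.
  by left; exists [::], [::], [::], [::]; split => //; apply: yields_nil.
- case: u => [|b u] /= E.
    left; exists [::], (inr a :: s), [::], v; split => //; first exact: yields_nil.
    by rewrite -E; apply: yields_ter.
  case: E => <- /IH[[s1 [s2 [v1 [v2 [-> -> y1 y2]]]]]|].
    by left; exists (inr a :: s1), s2, v1, v2; split => //; apply: yields_ter.
  move=> [N [s1 [s2 [u1 [u2 [t1 [t2 [v1 [v2 [Nr [-> -> ->] y1 y2 ctx]]]]]]]]]].
  right; exists N, s1, s2, (a :: u1), u2, t1, t2, v1, v2; split=> // L u0 t0 c.
  rewrite -cat_rcons; apply: ctx => y hy.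
  by rewrite cat_rcons; apply: (c (a :: y)); apply: yields_ter.
(* Either [v] lies in [w2], or it straddles [w1] and [w2], or it lies in [w1]. In the last case [N]
   is the lowest node unless one further down serves. *)
move=> /cat_eq_cat[[c [-> E]]|[c [w1E /esym/cat_eq_cat[]]]].
- case: (IHs _ _ _ E) => [[s1 [s2 [v1 [v2 [-> -> y1 y2]]]]]|].
    by left; exists (inl N :: s1), s2, v1, v2; rewrite -catA; split => //;
      apply: yields_nt yr y1.
  move=> [D [s1 [s2 [u1 [u2 [t1 [t2 [v1 [v2 [Dr [-> -> ->] y1 y2 ctx]]]]]]]]]].
  right; exists D, s1, s2, (w1 ++ u1), u2, t1, t2, v1, v2.
  rewrite -catA; split=> // L u0 t0 c0; rewrite catA; apply: ctx.
  have /context_cat : context L ([:: inl N] ++ s) u0 t0 by [].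
  by case/(_ _ _ (yields_rule Nr yr) ys).
- move=> [d [-> E]].
  left; exists [:: inl N], s, c, d; split => //; last by rewrite -E.
  by rewrite -w1E; apply: yields_rule Nr yr.
move=> [d [cE tE]]; rewrite {}cE in w1E; rewrite {}tE.
have ctxN L u0 t0 : context L (inl N :: s) u0 t0 ->
    context L [:: inl N] u0 (w2 ++ t0).
  move=> c0; have /context_cat : context L ([:: inl N] ++ s) u0 t0 by [].
  by case/(_ _ _ (yields_rule Nr yr) ys).
case: (IHr _ _ _ w1E) => [[s1 [s2 [v1 [v2 [rE -> y1 y2]]]]]|].
  right; exists N, s1, s2, [::], u, w2, d, v1, v2; rewrite -rE.
  by split => // L u0 t0 /ctxN; rewrite cats0.
move=> [D [s1 [s2 [u1 [u2 [t1 [t2 [v1 [v2 [Dr [-> -> ->] y1 y2 ctx]]]]]]]]]].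
right; exists D, s1, s2, u1, u2, (t1 ++ w2), t2, v1, v2.
split=> //; first by rewrite catA.
by move=> L u0 t0 /ctxN /(context_rule Nr) /ctx; rewrite -!catA.
Qed.

(* [sample N] is the junk word [::] when [N] derives no word. *)
Definition sample N := xget [::] [set w | yields [:: inl N] w]%classic.

Definition sample_word s :=
  flatten [seq (match x with inl N => sample N | inr a => [:: a] end) | x <- s].

Lemma sample_word_cat s1 s2 :
  sample_word (s1 ++ s2) = sample_word s1 ++ sample_word s2.
Proof. by rewrite /sample_word map_cat flatten_cat. Qed.

Lemma yields_sample_word s w : yields s w -> yields s (sample_word s).
Proof.
elim=> [|a {}s {}w _ IH|N r {}s w1 w2 Nr yr _ _ IHs]; first exact: yields_nil.
  exact: yields_ter.
apply: (@yields_cat [:: inl N] s) => //; rewrite /sample.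
case: xgetP => [y _ //|/(_ w1) []]; exact: yields_rule Nr yr.
Qed.

Lemma sample_word_bounded : exists K, forall N r, (N, r) \in rules Gr ->
  (size (sample N) <= K /\ size (sample_word r) <= K)%N.
Proof.
exists (\max_(p <- rules Gr) size (sample p.1) +
  \max_(p <- rules Gr) size (sample_word p.2))%N => N r Nr; split.
  apply/leq_trans/leq_addr.
  exact: (leq_bigmax_seq (F := fun p => size (sample p.1)) (N, r)).
apply/leq_trans/leq_addl.
exact: (leq_bigmax_seq (F := fun p => size (sample_word p.2)) (N, r)).
Qed.

End Yields.

(** * Loops in a labelled graph *)

Section Action.
Local Open Scope ring_scope.
Variables (V : Type) (A : Type) (act : V -> A -> V).
Implicit Types (p q : V) (w : seq A).

Definition run q w := foldl act q w.

Lemma run_cat q w1 w2 : run q (w1 ++ w2) = run (run q w1) w2.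
Proof. exact: foldl_cat. Qed.

Lemma run_rcons q w a : run q (rcons w a) = act (run q w) a.
Proof. exact: foldl_rcons. Qed.

Lemma run_inj w : (forall a, injective (act^~ a)) -> injective (run^~ w).
Proof. by move=> actI; elim: w => //= a w IHw p q /IHw /actI. Qed.

Fixpoint path_sum (c : V -> A -> int) q w : int :=
  if w is a :: w' then c q a + path_sum c (act q a) w' else 0.

Lemma path_sum_cat c q w1 w2 :
  path_sum c q (w1 ++ w2) = path_sum c q w1 + path_sum c (run q w1) w2.
Proof. by elim: w1 q => [|a w1 IH] q /=; rewrite ?add0r // IH addrA. Qed.

Lemma lipschitz_run (f : V -> int) (M : nat) q w :
  (forall q a, `|f (act q a) - f q| <= M) -> `|f (run q w) - f q| <= (M * size w)%:Z.
Proof. by move=> fM; elim: w q => [|a w IH] q /=; [lia|have := IH (act q a); have := fM q a; nia]. Qed.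

End Action.

Section Loops.
Local Open Scope ring_scope.
Variables (V : Type) (A : finType) (act : V -> A -> V) (eta : V).
Hypothesis actI : forall a, injective (act^~ a).
Local Notation run := (run act).

Definition loops : set (seq A) := [set w | run eta w = eta]%classic.

(** Both paths are completed to loops by the same [t], which acts injectively. *)
Lemma context_run (Gr : cfg A) (s : seq (nonterminal Gr + A)) u t y1 y2 :
  context loops s u t -> yields s y1 -> yields s y2 ->
  run (run eta u) y1 = run (run eta u) y2.
Proof.
move=> ctx /ctx h1 /ctx h2; apply: (run_inj (w := t) actI).
by move: h1 h2; rewrite /loops /= !run_cat => -> ->.
Qed.

(** Replacing subtrees by sample words, from the bottom up, exchanges only words of length at most
    [K] with common ends, on which [c] agrees; so all loops have the same sum. [K] comes from the
    grammar alone, and [c] may be chosen after it. *)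
Lemma context_free_path_sum : context_free loops ->
  exists K : nat, forall c : V -> A -> int,
    (forall p y y', (size y <= K)%N -> (size y' <= K)%N -> run p y = run p y' ->
       path_sum act c p y = path_sum act c p y') ->
    forall w, loops w -> path_sum act c eta w = 0.
Proof.
move=> [Gr LE]; have [K KP] := sample_word_bounded Gr; exists K => c cK.
have fill (s : seq (nonterminal Gr + A)) w : yields s w -> forall u t, context loops s u t ->
    path_sum act c (run eta u) w = path_sum act c (run eta u) (sample_word s).
  elim=> [|a {}s {}w ys IH|N r {}s w1 w2 Nr yr IHr ys IHs] u t ctx //=.
    have := IH (rcons u a) t; rewrite run_rcons => -> //.
    by move=> y hy; rewrite cat_rcons; apply: (ctx (a :: y)); apply: yields_ter.
  have [ctxN ctxs] := @context_cat _ _ _ [:: inl N] s _ _ _ _ ctx (yields_rule Nr yr) ys.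
  have ctxr := context_rule Nr ctxN.
  have [szN szr] := KP _ _ Nr.
  have yN : yields [:: inl N] (sample N).
    by have := yields_sample_word (yields_rule Nr yr); rewrite /sample_word /= cats0.
  have eN : run (run eta u) (sample_word r) = run (run eta u) (sample N).
    apply: (context_run ctxN) => //; apply: yields_rule Nr _.
    exact: yields_sample_word yr.
  have e1 := context_run ctxN (yields_rule Nr yr) yN.
  have -> : sample_word (inl N :: s) = sample N ++ sample_word s by [].
  rewrite !path_sum_cat (IHr _ _ ctxr) e1 (cK _ _ _ szr szN eN); congr (_ + _).
  by have := IHs _ _ ctxs; rewrite run_cat e1.
have ctx0 : context loops [:: inl (start Gr)] [::] [::].
  by move=> y hy; rewrite cats0 /= LE cfg_languageE.
have fill0 y : loops y ->
    path_sum act c eta y = path_sum act c eta (sample_word [:: inl (start Gr)]).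
  by rewrite {1}LE cfg_languageE => yw; apply: (fill _ _ yw [::] [::]).
(* The empty word is a loop, and its sum is 0. *)
by move=> w /fill0 ->; rewrite -(fill0 [::]).
Qed.

(** [f i] is a height: [v i] stays above [- C], and the part of [u i] still to be read, or of [t i]
    already read, is long only at low heights. At the lowest node around [v i] the two halves have
    short substitutes with the same ends, so the parts of [u i] and [t i] under this node reach only
    bounded depth and are short. Two indices then share the nonterminal and both parts. *)
Lemma context_free_interchange (u v t : nat -> seq A) (f : nat -> V -> int) (M C : nat) :
  context_free loops ->
  (forall i, loops (u i ++ v i ++ t i)) ->
  (forall i q a, `|f i (act q a) - f i q| <= M) ->
  (forall i v1 v2, v i = v1 ++ v2 -> - C%:Z <= f i (run eta (u i ++ v1))) ->
  (forall i u1 u2, u i = u1 ++ u2 ->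
     (size u2)%:Z <= C%:Z * (C%:Z - f i (run eta u1))) ->
  (forall i t1 t2, t i = t1 ++ t2 ->
     (size t1)%:Z <= C%:Z * (C%:Z - f i (run eta (u i ++ v i ++ t1)))) ->
  exists i j, (i < j)%N /\ loops (u j ++ v i ++ t j).
Proof.
move=> [Gr LE] uvt fM fv fu ft; have [K KP] := sample_word_bounded Gr.
(* The value of [C * (C - y)] at [y = - (C + M * K)], a lower bound for the height where [u2] starts
   and where [t2] ends. *)
pose K' := (C * (2 * C + M * K))%N.
pose T := (nonterminal Gr * K'.-bseq A * K'.-bseq A)%type.
pose P i (d : T) := exists u1 t2, [/\ u i = u1 ++ d.1.2, t i = d.2 ++ t2,
  yields [:: inl d.1.1] (d.1.2 ++ v i ++ d.2) & context loops [:: inl d.1.1] u1 t2].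
suff /choice[d dP] : forall i, exists d, P i d.
  have [i [j [ij dij]]] := pigeonhole d; exists i, j; split => //.
  have [u1 [t2 [_ _ yi _]]] := dP i.
  have [u1' [t2' [uj tj _ ctx]]] := dP j; rewrite -dij in uj tj ctx.
  by have := ctx _ yi; rewrite uj tj -!catA.
move=> i.
have [N [s1 [s2 [u1 [u2 [t1 [t2 [v1 [v2 [Nr [uE vE tE] y1 y2 ctx]]]]]]]]]] :
  exists N s1 s2 u1 u2 t1 t2 v1 v2,
     [/\ (N, s1 ++ s2) \in rules Gr,
       [/\ u i = u1 ++ u2, v i = v1 ++ v2 & t i = t2 ++ t1],
       yields s1 (u2 ++ v1), yields s2 (v2 ++ t2) & context loops [:: inl N] u1 t1].
  have ctx0 : context loops [:: inl (start Gr)] [::] [::].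
    by move=> y hy; rewrite cats0 /= LE cfg_languageE.
  have [r Nr yr] : exists2 r, (start Gr, r) \in rules Gr & yields r (u i ++ v i ++ t i).
    have : yields [:: inl (start Gr)] (u i ++ v i ++ t i).
      by have := uvt i; rewrite LE cfg_languageE.
    move E : [:: inl (start Gr)] => s ys; case: ys E => // N r s' w1 w2 Nr yr ys'.
    case=> NE s0; move: ys'; rewrite -s0; move E : [::] => s'' ys''.
    by case: ys'' E => //; rewrite cats0 NE; exists r.
  case: (yields_split yr erefl) => [[s1 [s2 [v1 [v2 [rE vE y1 y2]]]]]|].
    exists (start Gr), s1, s2, [::], (u i), [::], (t i), v1, v2.
    by rewrite -rE; split => //; split; rewrite ?cats0.
  move=> [D [s1 [s2 [u1 [u2 [t1 [t2 [v1 [v2 [Dr [uE vE tE] y1 y2 c]]]]]]]]]].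
  exists D, s1, s2, u1, u2, t1, t2, v1, v2; split => //.
  by have := c _ _ _ (context_rule Nr ctx0); rewrite cats0.
have [szN szr] := KP _ _ Nr; move: szr; rewrite sample_word_cat size_cat => szr.
have [ctx1 ctx2] := context_cat (context_rule Nr ctx) y1 y2.
(* The sample of [s1] joins the start of [u2] to the vertex after [u i ++ v1], and the sample of
   [s2] joins that vertex to the end of [t2]. *)
have e1 := context_run ctx1 y1 (yields_sample_word y1).
have e2 := context_run ctx2 y2 (yields_sample_word y2).
have l1 := lipschitz_run (run eta u1) (sample_word s1) (fM i).
have l2 := lipschitz_run (run eta (u i ++ v1)) (sample_word s2) (fM i).
have Ef1 : run eta (u i ++ v1) = run (run eta u1) (sample_word s1).
  by rewrite -e1 -run_cat uE -catA.
have Ef2 : run eta (u i ++ v i ++ t2) = run (run eta (u i ++ v1)) (sample_word s2).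
  have -> : u i ++ v1 = u1 ++ u2 ++ v1 by rewrite uE -catA.
  by rewrite -e2 -run_cat uE vE -!catA.
have := fv i _ _ vE; have := fu i _ _ uE; have := ft i _ _ tE.
rewrite Ef2 -Ef1 in l1 l2 *.
set a := f i _ in l2 *; set b := f i _ in l1 l2 *; set x := f i _ in l1 *.
move=> ht hu hb.
have k1 : (M * size (sample_word s1) <= M * K)%N by rewrite leq_mul2l; lia.
have k2 : (M * size (sample_word s2) <= M * K)%N by rewrite leq_mul2l; lia.
have hK y : - (C + M * K)%N%:Z <= y -> C%:Z * (C%:Z - y) <= K'%:Z.
  move=> hy; rewrite /K' PoszM; apply: ler_wpM2l => //; lia.
have su : (size u2 <= K')%N by have := hK x; lia.
have st : (size t2 <= K')%N by have := hK a; lia.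
exists (N, Bseq su, Bseq st), u1, t1; split => //=.
apply: yields_rule Nr _; rewrite vE catA -catA.
by have := yields_cat y1 y2; rewrite -!catA.
Qed.

End Loops.

(** * Schreier graphs of rays *)

Lemma take_mkseq (T : Type) (q : nat -> T) m n :
  (m <= n)%N -> mkseq q m = take m (mkseq q n).
Proof. by move=> mn; rewrite /mkseq -map_take take_iota (minn_idPl mn). Qed.

Section Rays.
Variable C : finType.
Implicit Types (g h : tree_aut C) (p q : nat -> C).

Lemma ray_eqP p q : (forall n, mkseq p n = mkseq q n) -> p = q.
Proof.
move=> pq; apply/funext => n; have := congr1 (nth (p 0) ^~ n) (pq n.+1).
by rewrite !nth_mkseq.
Qed.

Lemma ray_actM q g h : ray_act q (g * h)%g = ray_act (ray_act q g) h.
Proof. by apply: ray_eqP => n; rewrite !ray_act_prefix. Qed.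

Lemma ray_act1 q : ray_act q 1%g = q.
Proof. by apply: ray_eqP => n; rewrite ray_act_prefix. Qed.

Lemma ray_actK g : cancel (@ray_act C ^~ g) (@ray_act C ^~ g^-1%g).
Proof. by move=> q; rewrite -ray_actM mulgV ray_act1. Qed.

(** The default value of [nth] is used on purpose: past the end of [w] it reads the ray [p]. *)
Definition cat_ray (w : seq C) (p : nat -> C) : nat -> C :=
  fun n => nth (p (n - size w)) w n.

Lemma mkseq_cat_ray w p n : mkseq (cat_ray w p) (size w + n) = w ++ mkseq p n.
Proof.
apply: (@eq_from_nth _ (p 0)) => [|i]; first by rewrite size_mkseq size_cat size_mkseq.
rewrite size_mkseq => lti; rewrite nth_mkseq // nth_cat /cat_ray.
case: ltnP => iw; first exact: set_nth_default.
by rewrite nth_default // nth_mkseq //; lia.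
Qed.

Lemma cat_rayE q n : q = cat_ray (mkseq q n) (fun k => q (n + k)).
Proof.
apply/funext => k; rewrite /cat_ray size_mkseq; case: (ltnP k n) => kn.
  by rewrite nth_mkseq.
by rewrite nth_default ?size_mkseq // subnKC.
Qed.

Lemma cat_ray_prefix w p n : (n <= size w)%N -> mkseq (cat_ray w p) n = take n w.
Proof.
move=> nw; have := mkseq_cat_ray w p 0; rewrite addn0 cats0 => {2}<-.
by rewrite /mkseq -map_take take_iota; congr map; congr iota; lia.
Qed.

Lemma ray_act_cat_ray g w w' p : size w' = size w ->
  (forall v, g (w ++ v) = w' ++ v) -> ray_act (cat_ray w p) g = cat_ray w' p.
Proof.
move=> sw gw; apply/funext => n.
have := ray_act_prefix (cat_ray w p) g (size w + n.+1).
rewrite mkseq_cat_ray gw -mkseq_cat_ray sw.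
move/(congr1 (nth (p 0) ^~ n)); rewrite !nth_mkseq //; lia.
Qed.

End Rays.

Section Generation.
Variables (T : groupType) (S : set T).

Lemma subgroup_gen_sub s : S s -> subgroup_gen S s.
Proof. by move=> Ss H [_]; apply. Qed.

Lemma subgroup_gen1 : subgroup_gen S 1%g.
Proof. by move=> H [[/set_mem H1 _] _]. Qed.

Lemma subgroup_genM g h :
  subgroup_gen S g -> subgroup_gen S h -> subgroup_gen S (g * h)%g.
Proof.
move=> Sg Sh H cH; apply/set_mem/(group_closedM cH.1).
  exact/mem_set/(Sg _ cH).
exact/mem_set/(Sh _ cH).
Qed.

Lemma subgroup_genV g : subgroup_gen S g -> subgroup_gen S g^-1%g.
Proof.
by move=> Sg H cH; apply/set_mem/(group_closedV cH.1)/mem_set/(Sg _ cH).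
Qed.

Lemma subgroup_gen_ind (P : T -> Prop) : (forall s, S s -> P s) -> P 1%g ->
  (forall g h, P g -> P h -> P (g * h)%g) -> (forall g, P g -> P g^-1%g) ->
  forall g, subgroup_gen S g -> P g.
Proof.
move=> PS P1 PM PV g Sg; apply: (Sg P); split=> //; split; first exact: mem_set.
by move=> x y /set_mem Px /set_mem Py; apply/mem_set/PM => //; apply: PV.
Qed.

End Generation.

(** * Words over an arbitrary generating set *)

Section GeneratingWords.
Variables (C : finType) (G : set (tree_aut C)) (X : {fset tree_aut C}).
Hypothesis GX : symmetric_generating_set G X.
Implicit Types (w : seq X) (q eta : nat -> C).

Definition word_act q (x : X) := ray_act q (fsval x).

Lemma word_act_inj x : injective (word_act^~ x).
Proof. exact: can_inj (ray_actK (fsval x)). Qed.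

Lemma run_word_act q w : run word_act q w = ray_act q (\prod_(x <- w) fsval x)%g.
Proof.
elim: w q => [|x w IHw] q; first by rewrite big_nil ray_act1.
by rewrite big_cons ray_actM -IHw.
Qed.

Lemma prod_word_mem w : G (\prod_(x <- w) fsval x)%g.
Proof.
case: GX => _ <-; elim: w => [|x w IHw]; first by rewrite big_nil; apply: subgroup_gen1.
rewrite big_cons; apply: subgroup_genM => //; apply: subgroup_gen_sub.
exact: fsvalP.
Qed.

Lemma exists_word g : G g -> exists w, (\prod_(x <- w) fsval x)%g = g.
Proof.
case: GX => XV <-; elim/subgroup_gen_ind => {g} [x Xx||_ _ [v <-] [w <-]|_ [w <-]].
- by exists [:: [` Xx]%fset]; rewrite big_seq1.
- by exists [::]; rewrite big_nil.
- by exists (v ++ w); rewrite big_cat.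
elim: w => [|x w [v vE]]; first by exists [::]; rewrite big_nil invg1.
exists (rcons v [` XV _ (fsvalP x)]%fset).
by rewrite big_rcons /= big_cons invgM vE.
Qed.

Lemma WP_Stab eta : WP X (Stab G eta) = loops word_act eta.
Proof.
apply/seteqP; split=> w; rewrite /WP /Stab /loops /= run_word_act; first by case.
by split=> //; apply: prod_word_mem.
Qed.

(** Makes the choice of [X] harmless: walks in the named generators become words over [X], longer by
    a bounded factor only. *)
Lemma exists_spelling (S : seq (tree_aut C)) : (forall s, s \in S -> G s) ->
  exists (spell : tree_aut C -> seq X) (M : nat), forall s, s \in S ->
    (size (spell s) <= M)%N /\ forall q, run word_act q (spell s) = ray_act q s.
Proof.
move=> SG.
have /choice[sp spP] : forall s, exists w, s \in S ->
    forall q, run word_act q w = ray_act q s.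
  move=> s; have [/SG/exists_word[w wE]|_] := boolP (s \in S); last by exists [::].
  by exists w => _ q; rewrite run_word_act wE.
exists sp, (\max_(s <- S) size (sp s))%N => s sS; split; last exact: spP.
exact: (leq_bigmax_seq (F := fun s => size (sp s)) s).
Qed.

End GeneratingWords.

Section Spelling.
Variables (C : finType) (X : {fset tree_aut C}).
Variables (spell : tree_aut C -> seq X) (M : nat) (S : seq (tree_aut C)).
Hypothesis spellP : forall s, s \in S -> (size (spell s) <= M)%N /\
  forall q, run (@word_act C X) q (spell s) = ray_act q s.
Implicit Types (W : seq (tree_aut C)).

Definition spelling W := flatten (map spell W).

Lemma spelling_cat W1 W2 : spelling (W1 ++ W2) = spelling W1 ++ spelling W2.
Proof. by rewrite /spelling map_cat flatten_cat. Qed.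

Lemma run_spelling W q : {subset W <= S} ->
  run (@word_act C X) q (spelling W) = run (@ray_act C) q W.
Proof.
elim: W q => // s W IHW q WS.
have [_ sE] := spellP (WS s (mem_head _ _)).
rewrite /spelling /= run_cat sE IHW // => s' s'W.
by apply: WS; rewrite inE s'W orbT.
Qed.

Lemma size_spelling W : {subset W <= S} -> (size (spelling W) <= M * size W)%N.
Proof.
elim: W => [|s W IHW] WS //=; rewrite /spelling /= size_cat mulnS leq_add //.
  by have [] := spellP (WS s (mem_head _ _)).
by apply: IHW => s' s'W; apply: WS; rewrite inE s'W orbT.
Qed.

(** The cut falls in the spelling of one letter, counted in [W2]; [v] is the part of this spelling
    before the cut. *)
Lemma spelling_eq_cat W w1 w2 : {subset W <= S} -> spelling W = w1 ++ w2 ->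
  exists W1 W2 v, [/\ W = W1 ++ W2, w1 = spelling W1 ++ v, (size v <= M)%N,
    (size w1 <= M * (size W1).+1)%N & (size w2 <= M * size W2)%N].
Proof.
elim: W w1 => [|s W IHW] w1 WS.
  case: w1; case: w2 => //= _; exists [::], [::], [::]; split=> //; lia.
have sM := (spellP (WS s (mem_head _ _))).1.
have {}WS : {subset W <= S} by move=> s' s'W; apply: WS; rewrite inE s'W orbT.
have szW := size_spelling WS.
rewrite [X in X -> _]/= /spelling /= => /cat_eq_cat[[c [w1E /(IHW _ WS)]]|[c [sE w2E]]].
  move=> [W1 [W2 [v [-> cE szv sz1 sz2]]]]; exists (s :: W1), W2, v.
  split=> //; first by rewrite w1E cE catA.
  by rewrite w1E size_cat /= mulnS leq_add.
have := congr1 size sE; have := congr1 size w2E; rewrite !size_cat => e1 e2.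
exists [::], (s :: W), w1; split=> //=; rewrite /spelling in szW; nia.
Qed.

End Spelling.

(** * Lipschitz maps to cycles *)

Section LipschitzMod.
Local Open Scope ring_scope.

Lemma dvdzD_eq (d a b x : int) : (d %| a)%Z -> (d %| b)%Z -> x = a + b -> (d %| x)%Z.
Proof. by move=> da db ->; apply: rpredD. Qed.

Lemma dvdzB_eq (d a b x : int) : (d %| a)%Z -> (d %| b)%Z -> x = a - b -> (d %| x)%Z.
Proof. by move=> da db ->; apply: rpredB. Qed.

Lemma dvdz_double (n : nat) (x y : int) : (n %| x)%Z -> y = 2 * x -> ((2 * n)%N %| y)%Z.
Proof. by move=> nx ->; rewrite PoszM; apply: dvdz_mul. Qed.

Variable C : finType.
Implicit Types (g s : tree_aut C) (q : nat -> C) (r : (nat -> C) -> int) (n : nat).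

(* For [n = 0] the congruence is an equality of integers. *)
Definition moves_by n r M g := forall q, exists z : int,
  `|z| <= M%:Z /\ (n %| r (ray_act q g) - r q - z)%Z.

(** [M] is the length of a word for [g] in the generators and their inverses, hence the same for all
    [n] and [r]. *)
Lemma moves_by_subgroup_gen (S : set (tree_aut C)) g : subgroup_gen S g ->
  exists M : nat, forall n r, (forall s, S s -> moves_by n r 1 s) -> moves_by n r M g.
Proof.
elim/subgroup_gen_ind => {g} [s Ss||g h [M gM] [N hN]|g [M gM]].
- by exists 1%N => n r; apply.
- by exists 0%N => n r _ q; exists 0; rewrite ray_act1 subrr subr0 dvdz0.
- exists (M + N)%N => n r rS q; have [x [xM nx]] := gM n r rS q.
  have [y [yN ny]] := hN n r rS (ray_act q g); exists (x + y); split; first lia.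
  apply: (dvdzD_eq nx ny); rewrite ray_actM; lia.
exists M => n r rS q; have [x [xM nx]] := gM n r rS (ray_act q g^-1%g).
exists (- x); split; first by rewrite normrN.
rewrite -ray_actM mulVg ray_act1 in nx.
rewrite -rpredN; move: nx; apply: etrans; congr (_ %| _)%Z; lia.
Qed.

Lemma moves_by_alphabet (S : set (tree_aut C)) (X : {fset tree_aut C}) :
  symmetric_generating_set (subgroup_gen S) X ->
  exists M : nat, forall n r, (forall s, S s -> moves_by n r 1 s) ->
    forall x : X, moves_by n r M (fsval x).
Proof.
move=> [_ GX].
have /choice[m mP] : forall x : X, exists M : nat, forall n r,
    (forall s, S s -> moves_by n r 1 s) -> moves_by n r M (fsval x).
  move=> x; apply: moves_by_subgroup_gen; rewrite -GX.
  by apply: subgroup_gen_sub; apply: fsvalP.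
exists (\max_x m x)%N => n r rS x q; have [z [zm nz]] := mP x n r rS q.
by exists z; split=> //; apply: le_trans zm _; rewrite lez_nat; apply: leq_bigmax.
Qed.

(* [r] maps the Schreier graph to a cycle of length [n].  Following successors
   inside the finite set of vertices [ray t] gives a closed walk that winds
   around this cycle, although short closed walks do not. *)
Lemma no_winding_map (S : seq (tree_aut C)) (X : {fset tree_aut C}) eta :
  symmetric_generating_set (subgroup_gen [set` S]%classic) X ->
  context_free (WP X (Stab (subgroup_gen [set` S]%classic) eta)) ->
  exists n0 : nat, forall n r (T : finType) (ray : T -> nat -> C) t0 g,
    (n0 < n)%N -> (forall s, s \in S -> moves_by n r 1 s) ->
    subgroup_gen [set` S]%classic g -> ray_act eta g = ray t0 ->
    ~ (forall t, exists s t', [/\ s \in S, ray_act (ray t) s = ray t' &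
         (n %| r (ray t') - r (ray t) - 1)%Z]).
Proof.
move=> GX; rewrite (WP_Stab GX) => CF.
have [M MP] := moves_by_alphabet GX.
have SG s : s \in S -> subgroup_gen [set` S]%classic s by exact: subgroup_gen_sub.
have [spell [L spellP]] := exists_spelling GX SG.
have [K KP] := context_free_path_sum (@word_act_inj _ X) CF.
(* A multiple of [n] of absolute value below [n] is 0. This is applied to the difference of two
   words of length at most [K], and to a spelling of length at most [L] compared with 1. *)
exists (M * (2 * K) + M * L + 1)%N => n r T ray t0 g n0n rS Gg etag next.
(* [c] lifts the change of [r] modulo [n] along each edge to a small integer. *)
have [c cP] : exists c : (nat -> C) -> X -> int, forall q x,
    `|c q x| <= M%:Z /\ (n %| r (word_act q x) - r q - c q x)%Z.
  have /choice[c cP] : forall qx : (nat -> C) * X, exists z : int,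
      `|z| <= M%:Z /\ (n %| r (word_act qx.1 qx.2) - r qx.1 - z)%Z.
    by move=> [q x]; apply: (MP n r rS x q).
  by exists (fun q x => c (q, x)) => q x; apply: (cP (q, x)).
have c_bound q w : `|path_sum (@word_act C X) c q w| <= (M * size w)%N%:Z.
  elim: w q => [|x w IHw] q //=; have [cM _] := cP q x.
  have := IHw (word_act q x); rewrite mulnS PoszD /=; lia.
have c_mod q w :
    (n %| r (run (@word_act C X) q w) - r q - path_sum (@word_act C X) c q w)%Z.
  elim: w q => [|x w IHw] q /=; first by rewrite subrr subr0 dvdz0.
  have [_ cn] := cP q x; apply: (dvdzD_eq cn (IHw (word_act q x))).
  lia.
have small (z : int) : (n %| z)%Z -> `|z| < n%:Z -> z = 0.
  move=> nz zn; apply/eqP; apply: contraTT nz => z0.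
  by rewrite dvdzE /= gtnNdvd ?absz_gt0 //; lia.
have sum0 w : loops (@word_act C X) eta w -> path_sum (@word_act C X) c eta w = 0.
  apply: KP => p y y' yK y'K pyy'; apply/eqP; rewrite -subr_eq0; apply/eqP.
  apply: small.
    apply: (dvdzB_eq (c_mod p y') (c_mod p y)); rewrite pyy'.
    by move: (r _) (r _) (path_sum _ _ _ _) (path_sum _ _ _ _) => a b d e; lia.
  move: (c_bound p y) (c_bound p y'); move: (path_sum _ _ _ _) (path_sum _ _ _ _).
  have : (M * size y + M * size y' <= M * (2 * K))%N by rewrite -mulnDr leq_mul2l; lia.
  by move: (M * size y)%N (M * size y')%N; lia.
have /choice[sg /choice[nx nxP]] := next.
pose step t := spell (sg t).
have run_step t : run (@word_act C X) (ray t) (step t) = ray (nx t).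
  by have [sS <- _] := nxP t; rewrite (spellP _ sS).2.
have sum_step t : path_sum (@word_act C X) c (ray t) (step t) = 1.
  have [sS e n1] := nxP t; apply/eqP; rewrite -subr_eq0; apply/eqP; apply: small.
    by apply: (dvdzB_eq n1 (c_mod (ray t) (step t))); rewrite run_step; lia.
  have := c_bound (ray t) (step t); have := (spellP _ sS).1; rewrite -/(step t); nia.
pose walk k t := flatten [seq step x | x <- traject nx t k].
have run_walk k t : run (@word_act C X) (ray t) (walk k t) = ray (iter k nx t).
  elim: k t => // k IHk t.
  by rewrite /walk /= run_cat run_step -/(walk k (nx t)) IHk -iterSr.
have sum_walk k t : path_sum (@word_act C X) c (ray t) (walk k t) = k.
  elim: k t => // k IHk t.
  rewrite /walk /= path_sum_cat run_step sum_step -/(walk k (nx t)) IHk; lia.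
have [i [j [ij tij]]] := pigeonhole (fun i => iter i nx t0).
have [u uE] := exists_word GX Gg.
pose v := u ++ walk i t0; set t := iter i nx t0 in tij.
have run_v : run (@word_act C X) eta v = ray t.
  by rewrite run_cat (run_word_act eta u) uE etag run_walk.
have [v' v'E] := exists_word GX (subgroup_genV (prod_word_mem GX v)).
have run_v' : run (@word_act C X) (ray t) v' = eta.
  by rewrite -run_v !run_word_act v'E ray_actK.
have run_ij : run (@word_act C X) (ray t) (walk (j - i)%N t) = ray t.
  by rewrite run_walk /t -iterD (subnK (ltnW ij)) -tij.
have loopP (w : seq X) : run (@word_act C X) eta w = eta -> loops (@word_act C X) eta w by [].
have loop0 : loops (@word_act C X) eta (v ++ v').
  by apply: (loopP (v ++ v')); rewrite run_cat run_v.
have loop1 : loops (@word_act C X) eta (v ++ walk (j - i)%N t ++ v').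
  by apply: (loopP (v ++ walk _ t ++ v')); rewrite run_cat run_v run_cat run_ij.
(* The two loops differ by the closed walk, of sum [j - i], which is positive; yet both have sum
   0. *)
have := sum0 _ loop0; have := sum0 _ loop1.
rewrite (path_sum_cat _ _ _ v) run_v (path_sum_cat _ _ _ (walk _ _)) run_ij sum_walk.
rewrite path_sum_cat run_v.
by move: (path_sum _ _ _ _) (path_sum _ _ _ _); lia.
Qed.

End LipschitzMod.

(** * Transitivity on the levels *)

Section Orbits.
Variables (C : finType) (S : set (tree_aut C)).

Definition same_orbit (v w : seq C) := exists g, subgroup_gen S g /\ g v = w.

Lemma same_orbit_gen s v : S s -> same_orbit v (s v).
Proof. by move=> Ss; exists s; split=> //; apply: subgroup_gen_sub. Qed.

Lemma same_orbit_sym v w : same_orbit v w -> same_orbit w v.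
Proof.
move=> [g [Sg <-]]; exists (g^-1)%g; split; first exact: subgroup_genV.
exact: (aut_funK g).
Qed.

Lemma same_orbit_trans v w u : same_orbit v w -> same_orbit w u -> same_orbit v u.
Proof.
by move=> [g [Sg <-]] [h [Sh <-]]; exists (g * h)%g; split=> //; apply: subgroup_genM.
Qed.

(** Self-similarity: by the second hypothesis every element of the group can be imitated below the
    letter [x0], so induction on the length applies to the tail. *)
Lemma same_orbit_nseq x0 : (forall x w, same_orbit (x :: w) (x0 :: w)) ->
  (forall s w, S s -> same_orbit (x0 :: w) (x0 :: s w)) ->
  forall w, same_orbit w (nseq (size w) x0).
Proof.
move=> orb1 orbS.
have lift g : subgroup_gen S g -> forall w, same_orbit (x0 :: w) (x0 :: g w).
  elim/subgroup_gen_ind => {g} [s Ss w||g h IHg IHh w|g IHg w].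
  - exact: orbS.
  - by exists 1%g; split=> //; apply: subgroup_gen1.
  - exact: same_orbit_trans (IHg w) (IHh _).
  - by apply: same_orbit_sym; have := IHg (g^-1%g w); rewrite [g _](aut_invK g).
elim=> [|x w [g [Sg gw]]]; first by exists 1%g; split=> //; apply: subgroup_gen1.
apply: (same_orbit_trans (orb1 _ _)).
by have := lift _ Sg w; rewrite gw.
Qed.

Lemma same_orbit_ray eta w : same_orbit (mkseq eta (size w)) w ->
  exists g p, subgroup_gen S g /\ ray_act eta g = cat_ray w p.
Proof.
move=> [g [Sg gw]]; exists g, (fun k => ray_act eta g (size w + k)); split=> //.
by rewrite [LHS](cat_rayE _ (size w)) ray_act_prefix gw.
Qed.

End Orbits.

(** * The Basilica group *)

Section Basilica.
Local Open Scope ring_scope.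
Implicit Types (w v : seq 'I_2).

(* The cycle of [basilica_b] through the word 0...0 consists of the words
   whose second, fourth, ... letters are 0 ([on_b_cycle]); [b_coord] retracts
   the level onto it.  The [a]-versions describe the cycle of [basilica_a]. *)
Fixpoint on_a_cycle w := if w is x :: w' then (x == 0) && on_b_cycle w' else true
with on_b_cycle w := if w is x :: w' then on_a_cycle w' else true.

Fixpoint a_coord w : int := if w is x :: w' then b_coord w' else 0
with b_coord w : int :=
  if w is x :: w' then 2 * a_coord w' - ((x == 1) && on_a_cycle w')%:Z else 0.

(** The lengths of the two cycles: [basilica_a] acts as [basilica_b] below 0, and the square of
    [basilica_b] acts as [basilica_a] below either letter. *)
Fixpoint a_period n : nat := if n is n'.+1 then b_period n' else 1
with b_period n : nat := if n is n'.+1 then (2 * a_period n')%N else 1.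

Lemma b_period_odd k : b_period k.*2.+1 = (2 ^ k.+1)%N.
Proof. by elim: k => // k IHk; rewrite doubleS [RHS]expnS -IHk. Qed.

Lemma basilica_coordP w :
  [/\ b_coord (basilica_a w) = b_coord w /\ a_coord (basilica_b w) = a_coord w,
      (b_period (size w) %| b_coord (basilica_b w) - b_coord w - (on_b_cycle w)%:Z)%Z,
      (a_period (size w) %| a_coord (basilica_a w) - a_coord w - (on_a_cycle w)%:Z)%Z,
      on_b_cycle (basilica_b w) = on_b_cycle w &
      on_a_cycle (basilica_a w) = on_a_cycle w].
Proof.
elim: w => [|x w /= [[ba ab] bb aa onb ona]]; first by split.
case: (ord2_cases x) => ->; split=> //=; rewrite ?ab ?onb ?ona //.
- by apply: dvdz_double aa _; rewrite ?eqxx /= ; case: on_a_cycle => /=; lia.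
- by apply: dvdz_double (dvdz0 _) _; rewrite ?eqxx /=; case: on_a_cycle => /=; lia.
- by rewrite subrr subr0 dvdz0.
Qed.

(** By parity the section at [w] is trivial or [basilica_a], which fixes every word starting with
    1. *)
Lemma basilica_cat1 w v :
  (odd (size w) -> basilica_b (w ++ 1 :: v) = basilica_b w ++ 1 :: v) /\
  (~~ odd (size w) -> basilica_a (w ++ 1 :: v) = basilica_a w ++ 1 :: v).
Proof.
elim: w => [|x w /= [IHb IHa]]; first by split.
by case: (ord2_cases x) => ->; split=> //= ow; rewrite ?IHa // IHb // -[odd _]negbK.
Qed.

Lemma basilica_transitive w :
  same_orbit [set` [:: basilica_a; basilica_b]]%classic w (nseq (size w) 0).
Proof.
have Sa : [set` [:: basilica_a; basilica_b]]%classic basilica_a by rewrite /= inE eqxx.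
have Sb : [set` [:: basilica_a; basilica_b]]%classic basilica_b.
  by rewrite /= !inE eqxx orbT.
apply: same_orbit_nseq => [x {}w|s {}w].
  case: (ord2_cases x) => ->; last exact: same_orbit_gen Sb.
  by exists 1%g; split=> //; apply: subgroup_gen1.
rewrite /= !inE => /orP[] /eqP ->; last exact: same_orbit_gen Sa.
(* The square of [basilica_b] fixes the letter 0 and acts as [basilica_a] below it. *)
apply: (same_orbit_trans (same_orbit_gen _ Sb)).
exact: (same_orbit_gen (1 :: basilica_a w) Sb).
Qed.

Lemma basilica_not_context_free (X : {fset tree_aut 'I_2}) eta :
  symmetric_generating_set basilica_group X ->
  ~ context_free (WP X (Stab basilica_group eta)).
Proof.
rewrite /basilica_group.
have -> : [set basilica_a; basilica_b]%classic = [set` [:: basilica_a; basilica_b]]%classic.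
  apply/seteqP; split=> g /=; rewrite !inE; first by case=> ->; rewrite eqxx ?orbT.
  by case/orP=> /eqP ->; [left|right].
move=> GX /(no_winding_map GX)[n0]; set N := n0.*2.+1.
pose T := {w : N.-tuple 'I_2 | on_b_cycle w}.
(* As [N] is odd, the final 1 stops the action of [basilica_b], so all rays of the cycle share the
   tail [p]. *)
pose w0 := nseq N (0 : 'I_2) ++ [:: 1].
have [|g [p [Gg gE]]] := @same_orbit_ray _ [set` [:: basilica_a; basilica_b]]%classic eta w0.
  apply: same_orbit_trans (basilica_transitive _) _; rewrite size_mkseq.
  exact/same_orbit_sym/basilica_transitive.
pose ray (t : T) := cat_ray (val (val t) ++ [:: 1]) p.
have on0 : on_b_cycle (nseq_tuple N (0 : 'I_2)).
  have : on_a_cycle (nseq n0.*2 (0 : 'I_2)) by elim: (n0) => //= n ->.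
  by [].
move/(_ (b_period N) (fun q => b_coord (mkseq q N)) T ray (exist (fun w : N.-tuple 'I_2 => on_b_cycle w) _ on0) g); apply => //.
- rewrite b_period_odd; apply: leq_trans (ltn_expl n0 (ltnSn 1)) _.
  by rewrite leq_exp2l.
- move=> s; rewrite !inE => sS q; rewrite ray_act_prefix.
  have [[cba _] cbb _ _ _] := basilica_coordP (mkseq q N).
  rewrite size_mkseq in cbb.
  case/orP: sS => /eqP ->; first by exists 0; rewrite cba subrr subr0 dvdz0.
  by exists (on_b_cycle (mkseq q N))%:Z; split=> //; case: on_b_cycle.
move=> t; have [_ cbb _ onb _] := basilica_coordP (val (val t)).
have sz : size (basilica_b (val (val t))) == N by rewrite size_tree_aut size_tuple.
have on' : on_b_cycle (Tuple sz) by rewrite onb; apply: (valP t).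
have pre (u : T) : mkseq (ray u) N = val (val u).
  rewrite cat_ray_prefix ?size_cat ?size_tuple ?addn1 //.
  by rewrite take_size_cat // size_tuple.
exists basilica_b, (exist (fun w : N.-tuple 'I_2 => on_b_cycle w) _ on'); split; first by rewrite !inE eqxx orbT.
  apply: ray_act_cat_ray => [|v].
    by rewrite !size_cat size_tree_aut.
  rewrite -!catA /=; apply: (basilica_cat1 _ v).1.
  by rewrite size_tuple /= odd_double.
by rewrite !pre /=; move: cbb; rewrite size_tuple (valP t).
Qed.

End Basilica.

(** * The Hanoi tower group *)

Section Hanoi.
Local Open Scope ring_scope.
Implicit Types (x i j t : 'I_3) (w v : seq 'I_3).

(* [hanoi_gen j] fixes the peg [j] and exchanges the two others, the peg other
   than [x] and [j] being [- (x + j)]. *)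
Definition hanoi_gen j := if j == 0 then hanoi_c else if j == 1 then hanoi_b else hanoi_a.

Lemma hanoi_gen_cons j x w :
  hanoi_gen j (x :: w) = if x == j then x :: hanoi_gen j w else - (x + j) :: w.
Proof.
by case: (ord3_cases j) => ->; case: (ord3_cases x) => -> //=; congr (_ :: _); apply/val_inj.
Qed.

Lemma hanoi_gen_cat j w v w' : hanoi_gen j w = w' -> has (predC1 j) w ->
  hanoi_gen j (w ++ v) = w' ++ v.
Proof.
move=> <-; elim: w => // x w IHw; rewrite cat_cons !hanoi_gen_cons /=.
by case: eqP => //= _ /IHw ->.
Qed.

(* Three copies of a smaller Hanoi graph, indexed by the last letter [e], meet
   along a central cycle of length [3 * 2 ^ m], which crosses copy [e] from the
   corner [e + 1] to the corner [e + 2].  [target d w] is the peg to which the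
   discs smaller than those of [w] go on the way to the corner [e + d], and
   [winding w] is [e * 2 ^ m] plus the distance to the corner [e + 1]. *)
Fixpoint target (d : 'I_3) w :=
  if w is x :: w' then if w' is [::] then x + d else - (x + target d w') else 0.

Fixpoint winding w : int :=
  if w is x :: w' then
    if w' is [::] then (x : nat)%:Z else 2 * winding w' + (x != target 1 w')%:Z
  else 0.

Fixpoint on_cycle w :=
  if w is x :: w' then
    if w' is [::] then true
    else ((x == target 1 w') || (x == target 2 w')) && on_cycle w'
  else true.

Lemma hanoi_gen_neq0 j w : w != [::] -> hanoi_gen j w != [::].
Proof. by rewrite -!size_eq0 size_tree_aut. Qed.

Lemma target_cons d x w : w != [::] -> target d (x :: w) = - (x + target d w).
Proof. by case: w. Qed.

Lemma winding_cons x w : w != [::] ->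
  winding (x :: w) = 2 * winding w + (x != target 1 w)%:Z.
Proof. by case: w. Qed.

Lemma on_cycle_cons x w : w != [::] ->
  on_cycle (x :: w) = ((x == target 1 w) || (x == target 2 w)) && on_cycle w.
Proof. by case: w. Qed.

(** Prepending [j] doubles the sum of [winding] and the correction [target 1 w != j], so the
    congruence passes to the doubled modulus. It follows that a generator moves [winding] by at most
    1. *)
Lemma winding_gen j w : w != [::] ->
  ((3 * 2 ^ (size w).-1)%N %| (winding (hanoi_gen j w) + (target 1%R (hanoi_gen j w) != j)%:Z) -
     (winding w + (target 1%R w != j)%:Z))%Z.
Proof.
elim: w => // x w IHw _; have [->|w0] := eqVneq w [::].
  by case: (ord3_cases j) => ->; case: (ord3_cases x) => ->.
have -> : (3 * 2 ^ (size (x :: w)).-1 = 2 * (3 * 2 ^ (size w).-1))%N.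
  by case: (w) w0 => //= *; rewrite expnS mulnCA.
rewrite hanoi_gen_cons; case: eqP => [->|/eqP xj].
  apply: dvdz_double (IHw w0) _.
  have hw0 := hanoi_gen_neq0 j w0.
  rewrite !(winding_cons _ w0) !(winding_cons _ hw0) !(target_cons _ _ w0) !(target_cons _ _ hw0).
  have e t : (- (j + t) != j) = (t != j).
    by case: (ord3_cases j) => ->; case: (ord3_cases t) => ->.
  by rewrite !e ![j == _]eq_sym; do 2!case: (_ != j) => /=; lia.
rewrite !(winding_cons _ w0) !(target_cons _ _ w0).
have e : (x != target 1 w)%:Z + (- (x + target 1 w) != j)%:Z =
    (- (x + j) != target 1 w)%:Z + (- (- (x + j) + target 1 w) != j)%:Z.
  move: xj (target 1 w) => + t.
  by case: (ord3_cases j) => ->; case: (ord3_cases x) => ->; case: (ord3_cases t) => ->.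
apply: dvdz_double (dvdz0 _) _; move: (winding w) e => z.
by do 4!case: (_ != _) => /=; lia.
Qed.

Lemma target_neq w : w != [::] -> on_cycle w -> target 1 w != target 2 w.
Proof.
elim: w => // x w IHw _; have [->|w0] := eqVneq w [::].
  by case: (ord3_cases x) => ->.
rewrite on_cycle_cons // !target_cons // => /andP[_ /(IHw w0)]; apply: contraNneq.
by move/oppr_inj/addrI=> ->.
Qed.

(** This is the next move towards the corner [e + 2], or from there into the copy [e + 1]. The same
    generator leads back, whence [target 1 w' = target 2 w]. *)
Lemma on_cycle_next w : w != [::] -> on_cycle w ->
  let w' := hanoi_gen (target 2 w) w in
  [/\ on_cycle w', target 1 w' = target 2 w, has (predC1 (target 2 w)) w &
   ((3 * 2 ^ (size w).-1)%N %| winding w' - winding w - 1)%Z].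
Proof.
elim: w => // x w IHw _; have [->|w0] := eqVneq w [::].
  by case: (ord3_cases x) => ->; split=> //; apply/val_inj.
rewrite on_cycle_cons // => /andP[xw ow]; have tneq := target_neq w0 ow.
have -> : (3 * 2 ^ (size (x :: w)).-1 = 2 * (3 * 2 ^ (size w).-1))%N.
  by case: (w) w0 => //= *; rewrite expnS mulnCA.
have [ow' tw' hw' nw'] := IHw w0 ow.
(* Either the first disc moves from [target 1 w] to [target 2 w], or it is already there and a disc
   of [w] moves. *)
rewrite hanoi_gen_cons !target_cons //; case/orP: xw => /eqP ->.
  have tt : - (target 1 w + target 2 w) != target 1 w.
    by move: tneq; case: (ord3_cases (target 1 w)) => ->;
      case: (ord3_cases (target 2 w)) => ->.
  rewrite eq_sym (negbTE tt) opprD opprK addKr.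
  split; first by rewrite on_cycle_cons // eqxx orbT.
  - by rewrite target_cons // addrC.
  - by rewrite /= eq_sym tt.
  rewrite !winding_cons // eqxx eq_sym tneq.
  by apply: dvdz_double (dvdz0 _) _; lia.
have hw0 := hanoi_gen_neq0 (target 2 w) w0.
have t2 t : - (t + t) = t by case: (ord3_cases t) => ->; apply/val_inj.
rewrite t2 eqxx; split.
- by rewrite (on_cycle_cons _ hw0) tw' eqxx.
- by rewrite (target_cons _ _ hw0) tw' t2.
- by rewrite /= hw' orbT.
apply: dvdz_double nw' _.
by rewrite (winding_cons _ w0) (winding_cons _ hw0) tw' eqxx eq_sym tneq; lia.
Qed.

Lemma exists_on_cycle n : exists w, size w = n.+1 /\ on_cycle w.
Proof.
elim: n => [|n [w [sw ow]]]; first by exists [:: 0].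
exists (target 1 w :: w); split; first by rewrite /= sw.
by rewrite on_cycle_cons ?eqxx // -size_eq0 sw.
Qed.

Lemma hanoi_gen_mem j : hanoi_gen j \in [:: hanoi_a; hanoi_b; hanoi_c].
Proof. by rewrite !inE /hanoi_gen; do 2?case: ifP => _; rewrite eqxx ?orbT. Qed.

Lemma hanoi_transitive w :
  same_orbit [set` [:: hanoi_a; hanoi_b; hanoi_c]]%classic w (nseq (size w) 0).
Proof.
have orb j v : same_orbit [set` [:: hanoi_a; hanoi_b; hanoi_c]]%classic v (hanoi_gen j v).
  exact: same_orbit_gen (hanoi_gen_mem j).
have Sgen s : s \in [:: hanoi_a; hanoi_b; hanoi_c] -> exists j, s = hanoi_gen j.
  by rewrite !inE => /or3P[] /eqP ->; [exists 2|exists 1|exists 0].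
have orb1 x v : same_orbit [set` [:: hanoi_a; hanoi_b; hanoi_c]]%classic (x :: v) (0 :: v).
  have [->|x0] := eqVneq x 0; first by exists 1%g; split=> //; apply: subgroup_gen1.
  have := orb (- x) (x :: v); rewrite hanoi_gen_cons subrr oppr0.
  by move: x0; case: (ord3_cases x) => ->.
apply: same_orbit_nseq => // s {}w /Sgen[j ->].
(* [hanoi_gen j] acts as itself below the letter [j], so the first letter is changed from 0 to [j]
   and back. *)
apply: same_orbit_trans (same_orbit_sym (orb1 j w)) _.
apply: same_orbit_trans (orb j _) _; rewrite hanoi_gen_cons eqxx; exact: orb1.
Qed.

Lemma hanoi_not_context_free (X : {fset tree_aut 'I_3}) eta :
  symmetric_generating_set hanoi_group X ->
  ~ context_free (WP X (Stab hanoi_group eta)).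
Proof.
rewrite /hanoi_group; set S := [:: hanoi_a; hanoi_b; hanoi_c].
have -> : [set hanoi_a; hanoi_b; hanoi_c]%classic = [set` S]%classic.
  apply/seteqP; split=> g /=; rewrite /S !inE.
    by case=> [[]|] ->; rewrite eqxx ?orbT.
  by case/or3P=> /eqP ->; [left; left|left; right|right].
move=> GX /(no_winding_map GX)[n0]; set N := n0.+1.
pose T := {w : N.-tuple 'I_3 | on_cycle w}.
have [w0 [sw0 ow0]] := exists_on_cycle n0.
have [|g [p [Gg gE]]] := @same_orbit_ray _ [set` S]%classic eta w0.
  apply: same_orbit_trans (hanoi_transitive _) _; rewrite size_mkseq.
  exact/same_orbit_sym/hanoi_transitive.
pose ray (t : T) := cat_ray (val (val t)) p.
pose t0 : N.-tuple 'I_3 := tcast sw0 (in_tuple w0).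
have t0E : t0 = w0 :> seq _ by rewrite val_tcast.
have on0 : on_cycle t0 by rewrite t0E.
have n0' k v : size v = k.+1 -> v != [::] by case: v.
move/(_ (3 * 2 ^ n0)%N (fun q => winding (mkseq q N)) T ray
  (exist (fun w : N.-tuple 'I_3 => on_cycle w) _ on0) g); apply => //.
- by have := ltn_expl n0 (ltnSn 1); lia.
- move=> s sS q; rewrite ray_act_prefix.
  have [j ->] : exists j, s = hanoi_gen j.
    by move: sS; rewrite !inE => /or3P[] /eqP ->; [exists 2|exists 1|exists 0].
  have := @winding_gen j (mkseq q N); rewrite size_mkseq => /(_ isT) d.
  exists ((target 1 (mkseq q N) != j)%:Z - (target 1 (hanoi_gen j (mkseq q N)) != j)%:Z).
  split; first by do 2!case: (_ != j).
  by move: d; apply: etrans; congr (_ %| _)%Z; lia.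
- by rewrite gE /ray /= t0E.
move=> t; set w := val (val t).
have sw : size w = N by rewrite size_tuple.
have [on' _ hw nw] := on_cycle_next (n0' _ _ sw) (valP t).
have sz : size (hanoi_gen (target 2 w) w) == N by rewrite size_tree_aut sw.
have {}on' : on_cycle (Tuple sz) by [].
have pre (u : T) : mkseq (ray u) N = val (val u).
  by rewrite cat_ray_prefix ?size_tuple // take_oversize ?size_tuple.
exists (hanoi_gen (target 2 w)), (exist (fun w : N.-tuple 'I_3 => on_cycle w) _ on').
split; first exact: hanoi_gen_mem.
  apply: ray_act_cat_ray => [|v]; first by rewrite size_tree_aut.
  exact: hanoi_gen_cat.
by rewrite !pre /=; move: nw; rewrite sw.
Qed.

End Hanoi.

(** * The Grigorchuk group *)

Section Grigorchuk.
Local Open Scope ring_scope.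
Implicit Types (x : 'I_2) (w v : seq 'I_2) (q eta : nat -> 'I_2).

Definition grig_gens := [:: grig_a; grig_b; grig_c; grig_d].
Local Notation S := grig_gens.

(* Gray code: every level of the Schreier graph is a segment, on which
   [gray w] is the position of [w], the end 1...1 having position 0. *)
Fixpoint gray w : nat :=
  if w is x :: w' then ((gray w').*2 + ((x == 1%R) == odd (gray w')))%N else 0%N.

Lemma gray_a w : (gray (grig_a w))./2 = (gray w)./2.
Proof. by case: w => //= x w; case: (ord2_cases x) => -> /=; lia. Qed.

Lemma uphalf_gray0 m : uphalf (m.*2 + (false == odd m)) = m./2.*2.+1.
Proof.
by have := odd_double_half m; case: odd => /= <-; rewrite uphalf_half ?oddD ?odd_double /=; lia.
Qed.

Lemma uphalf_gray1 m : uphalf (m.*2 + (true == odd m)) = (uphalf m).*2.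
Proof.
by have := odd_double_half m; rewrite !uphalf_half; case: odd => /= <-; rewrite ?oddD ?odd_double /=; lia.
Qed.

(** These generators preserve the pairs of positions 2k - 1 and 2k, whereas [grig_a] exchanges 2k
    and 2k + 1. Below 0 the tail moves within a pair of the latter kind, below 1 within one of the
    former. *)
Lemma gray_bcd w : [/\ uphalf (gray (grig_b w)) = uphalf (gray w),
  uphalf (gray (grig_c w)) = uphalf (gray w) & uphalf (gray (grig_d w)) = uphalf (gray w)].
Proof.
elim: w => //= x w [/= IHb IHc IHd]; have /= := gray_a w.
by case: (ord2_cases x) => -> ha; split; rewrite ?eqxx /= ?uphalf_gray0 ?uphalf_gray1 ?ha ?IHb ?IHc ?IHd.
Qed.

Lemma gray_gen s w : s \in S -> (gray (s w) <= (gray w).+1)%N /\ (gray w <= (gray (s w)).+1)%N.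
Proof.
rewrite !inE; have := gray_a w; have [] := gray_bcd w.
by move=> hb hc hd ha /or4P[] /eqP ->; lia.
Qed.

Lemma gray_cat w v :
  (2 ^ size w * gray v <= gray (w ++ v) < 2 ^ size w * (gray v).+1)%N.
Proof.
elim: w => [|x w IHw] /=; first by rewrite expn0 !mul1n leqnn ltnSn.
by rewrite expnS -!mulnA; case: (_ == odd _) => /=; lia.
Qed.

Lemma gray_inj v w : size v = size w -> gray v = gray w -> v = w.
Proof.
elim: v w => [|x v IHv] [|y w] //= [sz] e.
have evw : v = w by apply: IHv => //; lia.
move: e; rewrite evw; case: (ord2_cases x) => ->; case: (ord2_cases y) => -> //=.
  by case: odd => /=; lia.
by case: odd => /=; lia.
Qed.

(** Passing a leading 1 permutes the three generators cyclically, and at the first 0 [grig_b]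
    changes the next letter. Odd positions exclude the end 1...1, and the bound excludes the end
    1...10. *)
Lemma gray_moved w : odd (gray w) -> ((gray w).+1 < 2 ^ size w)%N ->
  exists s, s \in [:: grig_b; grig_c; grig_d] /\ s w <> w.
Proof.
elim: w => //= x w IHw; case: (ord2_cases x) => -> /=.
  move=> _ lt_w; exists grig_b; rewrite inE eqxx; split=> //=.
  case: w lt_w {IHw} => [|y w] //= _.
  by case: (ord2_cases y) => ->.
rewrite oddD odd_double oddb => /eqP ow; rewrite -ow expnS => lt_w.
have [|s [+ sw]] := IHw (esym ow); first by move: lt_w => /=; lia.
rewrite !inE => /or3P[] /eqP sE; [exists grig_d|exists grig_b|exists grig_c];
  rewrite !inE eqxx ?orbT; split=> //= -[]; by rewrite -/(s w) sE in sw *.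
Qed.

Lemma gray_step w : ((gray w).+1 < 2 ^ size w)%N ->
  exists2 s, s \in S & gray (s w) = (gray w).+1.
Proof.
move=> lt_w; case: (boolP (odd (gray w))) => ow.
  have [s [sS sw]] := gray_moved ow lt_w; exists s; first by rewrite inE sS orbT.
  have : gray (s w) <> gray w by move=> /gray_inj; rewrite size_tree_aut => /(_ erefl).
  have := gray_bcd w; move: sS; rewrite !inE.
  by move=> /or3P[] /eqP -> [hb hc hd]; lia.
exists grig_a; first by rewrite inE eqxx.
case: w lt_w ow => [|x w] //= _; rewrite oddD odd_double oddb.
by case: (ord2_cases x) => -> /=; case: odd => //= _; lia.
Qed.

Lemma gray_path N q j : (gray (mkseq q N) + j < 2 ^ N)%N ->
  exists W, [/\ {subset W <= S}, size W = j & forall W1 W2, W = W1 ++ W2 ->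
    gray (mkseq (run (@ray_act _) q W1) N) = (gray (mkseq q N) + size W1)%N].
Proof.
elim: j q => [|j IHj] q lt_q.
  by exists [::]; split=> // -[|//] _ _; rewrite addn0.
have [|s sS gs] := @gray_step (mkseq q N); first by rewrite size_mkseq; lia.
rewrite -ray_act_prefix in gs.
have [|W [WS <- WP]] := IHj (ray_act q s); first by rewrite gs; lia.
exists (s :: W); split=> // [s'|[|s' W1] W2 /=].
- by rewrite inE => /orP[/eqP ->|/WS].
- by rewrite addn0.
by case=> <- /WP ->; rewrite gs addSnnS.
Qed.

Lemma run_rev W q : {subset W <= S} ->
  run (@ray_act _) (run (@ray_act _) q W) (rev W) = q.
Proof.
elim: W q => //= s W IHW q WS; rewrite rev_cons run_rcons IHW; last first.
  by move=> s' s'W; apply: WS; rewrite inE s'W orbT.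
apply: ray_eqP => n; rewrite !ray_act_prefix.
have := WS s (mem_head _ _); rewrite !inE => /or4P[] /eqP ->.
- exact: grig_aK.
- exact: grig_bK.
- exact: grig_cK.
- exact: grig_dK.
Qed.

(* One of [grig_b], [grig_c], [grig_d] fixes the words 1...10..., according to
   the number of their leading letters 1 modulo 3. *)
Definition fixer (k : nat) :=
  if (k %% 3 == 0)%N then grig_d else if (k %% 3 == 1)%N then grig_c else grig_b.

Lemma fixer_mem k : fixer k \in S.
Proof. by rewrite /fixer !inE; do 2?case: ifP => _; rewrite eqxx ?orbT. Qed.

Lemma fixer_cons1 m w : fixer m.+1 (1 :: w) = 1 :: fixer m w.
Proof.
rewrite /fixer (_ : m.+1 %% 3 = (m %% 3 + 1) %% 3)%N; last by rewrite modnDml addn1.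
have : (m %% 3 < 3)%N by rewrite ltn_mod.
by case: (m %% 3)%N => [|[|[|//]]].
Qed.

Lemma fixer_ones k m w : fixer (m + k) (nseq k 1 ++ w) = nseq k 1 ++ fixer m w.
Proof.
by elim: k => [|k IHk]; rewrite ?addn0 // addnS cat_cons fixer_cons1 IHk.
Qed.

Lemma gray_ones k w : ~~ odd (gray w) -> gray (nseq k 1 ++ w) = (2 ^ k * gray w)%N.
Proof.
move=> ew; elim: k => [|k /= ->]; first by rewrite mul1n.
have ev : ~~ odd (2 ^ k * gray w)%N by rewrite oddM (negbTE ew) andbF.
by rewrite (negbTE ev) addn0 expnS -mulnA mul2n.
Qed.

Lemma gray_last k : (gray (nseq k 1 ++ [:: 0])).+1 = (2 ^ k.+1)%N.
Proof.
elim: k => // k IHk /=.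
have -> : odd (gray (nseq k 1 ++ [:: 0])) by move: IHk; rewrite expnS; lia.
by rewrite !eqxx [RHS]expnS -IHk mul2n doubleS addn1.
Qed.

(* A straight path from [eta] to the far end of level [n + 3], through the
   word 1...1010 which differs from that end in its letter [n] only. *)
Lemma straight_path n eta : (eta n.+1, eta n.+2) <> (1, 0) ->
  exists U W, [/\ {subset U <= S}, {subset W <= S},
   mkseq (run (@ray_act _) eta U) n.+3 = nseq n 1 ++ [:: 0; 1; 0] /\
   mkseq (run (@ray_act _) eta (U ++ W)) n.+3 = nseq n.+2 1 ++ [:: 0],
   forall U1 U2, U = U1 ++ U2 ->
     (gray (mkseq (run (@ray_act _) eta U1) n.+3) + size U2 = 3 * 2 ^ n.+1)%N &
   forall W1 W2, W = W1 ++ W2 ->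
     (3 * 2 ^ n.+1 <= gray (mkseq (run (@ray_act _) eta (U ++ W1)) n.+3))%N].
Proof.
move=> eta_n.
(* The words ending in 10 form the last quarter of the level, from position [3 * 2 ^ n.+1] on. *)
have lt_eta : (gray (mkseq eta n.+3) < 3 * 2 ^ n.+1)%N.
  have -> : mkseq eta n.+3 = mkseq eta n.+1 ++ [:: eta n.+1; eta n.+2].
    by rewrite /mkseq -[n.+3](addn2 n.+1) iotaD map_cat.
  have := gray_cat (mkseq eta n.+1) [:: eta n.+1; eta n.+2].
  rewrite size_mkseq => /andP[_ /leq_trans]; apply; rewrite mulnC leq_mul2r.
  by move: eta_n; case: (ord2_cases (eta n.+1)) => ->; case: (ord2_cases (eta n.+2)) => ->;
    rewrite ?orbT.
have e3 : (2 ^ n.+3 = 4 * 2 ^ n.+1)%N by rewrite !expnS mulnA.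
have pos : (0 < 2 ^ n.+1)%N by rewrite expn_gt0.
have [|U [US sU UP]] := @gray_path n.+3 eta (3 * 2 ^ n.+1 - gray (mkseq eta n.+3)).
  by rewrite subnKC ?e3 ?ltn_mul2r ?pos // ltnW.
have gp : gray (mkseq (run (@ray_act _) eta U) n.+3) = (3 * 2 ^ n.+1)%N.
  by rewrite (UP U [::]) ?cats0 // sU; lia.
have [|W [WS sW WP]] := @gray_path n.+3 (run (@ray_act _) eta U) (2 ^ n.+1).-1.
  by rewrite gp e3; lia.
exists U, W; split=> //.
- split; apply: gray_inj; rewrite ?size_mkseq ?size_cat ?size_nseq ?addn3 ?addn1 //.
    by rewrite gp gray_ones //= expnS; lia.
  apply: succn_inj; rewrite gray_last e3 run_cat (WP W [::]) ?cats0 // gp sW; lia.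
- by move=> U1 U2 UE; rewrite (UP _ _ UE); have := congr1 size UE; rewrite size_cat sU; lia.
- by move=> W1 W2 WE; rewrite run_cat (WP _ _ WE) gp leq_addr.
Qed.

(** Of two overlapping pairs of letters at most one is 10, so [n_ i] can be taken to be 2i or 2i +
    1. *)
Lemma frequently_not_10 eta : exists n_ : nat -> nat, (forall i j, (i < j -> n_ i < n_ j)%N) /\
  forall i, (eta (n_ i).+1, eta (n_ i).+2) <> (1, 0).
Proof.
have /choice[n_ nP] : forall i, exists n : nat, (i.*2 <= n <= i.*2.+1)%N /\
    (eta n.+1, eta n.+2) <> (1, 0).
  move=> i; case: (eqVneq (eta i.*2.+1, eta i.*2.+2) (1, 0)) => [[_ e]|/eqP ne].
    by exists i.*2.+1; rewrite e leqnSn leqnn.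
  by exists i.*2; rewrite leqnSn leqnn.
exists n_; split=> [i j ij|i]; last by case: (nP i).
by have [] := nP i; have [] := nP j; lia.
Qed.

Lemma grigorchuk_not_context_free (X : {fset tree_aut 'I_2}) eta :
  symmetric_generating_set grigorchuk_group X ->
  ~ context_free (WP X (Stab grigorchuk_group eta)).
Proof.
rewrite /grigorchuk_group.
have -> : [set grig_a; grig_b; grig_c; grig_d]%classic = [set` S]%classic.
  apply/seteqP; split=> g /=; rewrite !inE.
    by case=> [[[]|]|] ->; rewrite eqxx ?orbT.
  by case/or4P=> /eqP ->; [left; left; left|left; left; right|left; right|right].
move=> GX; rewrite (WP_Stab GX) => CF.
have [M MP] := moves_by_alphabet GX.
have SG s : s \in S -> subgroup_gen [set` S]%classic s by exact: subgroup_gen_sub.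
have [spell [L spellP]] := exists_spelling GX SG.
have run_sp q Y : {subset Y <= S} ->
    run (@word_act _ X) q (spelling spell Y) = run (@ray_act _) q Y.
  exact: (run_spelling spellP).
have [n_ [n_incr n_good]] := frequently_not_10 eta.
have /choice[U /choice[W UW]] := fun i => straight_path (n_good i).
(* The generator that fixes the far end 1...10, which has [n_ i + 2] letters 1. *)
pose l i := fixer (n_ i).+2.
pose V i := W i ++ l i :: rev (W i).
(* The position relative to the end of [U i]. *)
pose f i q := (gray (mkseq q (n_ i).+3))%:Z - (3 * 2 ^ (n_ i).+1)%N%:Z.
have US i : {subset U i <= S} by case: (UW i).
have WS i : {subset W i <= S} by case: (UW i).
have revS Y : {subset Y <= S} -> {subset rev Y <= S}.
  by move=> YS s; rewrite mem_rev; apply: YS.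
have catS Y1 Y2 : {subset Y1 <= S} -> {subset Y2 <= S} -> {subset Y1 ++ Y2 <= S}.
  by move=> S1 S2 s; rewrite mem_cat => /orP[/S1|/S2].
have VS i : {subset V i <= S}.
  apply: catS => // s; rewrite inE => /orP[/eqP ->|]; first exact: fixer_mem.
  exact: revS.
have cat_subl Y Y1 Y2 : {subset Y <= S} -> Y = Y1 ++ Y2 -> {subset Y1 <= S}.
  by move=> YS YE s sY; apply: YS; rewrite YE mem_cat sY.
have cat_subr Y Y1 Y2 : {subset Y <= S} -> Y = Y1 ++ Y2 -> {subset Y2 <= S}.
  by move=> YS YE s sY; apply: YS; rewrite YE mem_cat sY orbT.
have retrace q Y Y1 Y2 : {subset Y <= S} -> rev Y = Y1 ++ Y2 ->
    run (@ray_act _) (run (@ray_act _) q Y) Y1 = run (@ray_act _) q (rev Y2).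
  move=> YS YE; have YE' : Y = rev Y2 ++ rev Y1 by rewrite -rev_cat -YE revK.
  rewrite YE' run_cat -[X in run _ _ X](revK Y1) run_rev //.
  exact: cat_subr YS YE'.
have l_fix i : ray_act (run (@ray_act _) eta (U i ++ W i)) (l i) =
    run (@ray_act _) eta (U i ++ W i).
  have [_ _ [_ e] _ _] := UW i.
  rewrite [X in ray_act X _](cat_rayE _ (n_ i).+3) [RHS](cat_rayE _ (n_ i).+3) e.
  apply: ray_act_cat_ray => // v.
  by rewrite -catA /l -[(n_ i).+2]add0n fixer_ones.
have V_loop i : run (@ray_act _) (run (@ray_act _) eta (U i)) (V i) =
    run (@ray_act _) eta (U i).
  by rewrite -run_cat /V catA run_cat /= l_fix run_cat run_rev.
pose u i := spelling spell (U i).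
pose v i := spelling spell (V i).
pose t i := spelling spell (rev (U i)).
(* [M * L] bounds the change of height along the spelling of one generator, and [L] its length. *)
pose C := (M * L + L + 1)%N.
have f_letter i q (x : X) : `|f i (word_act q x) - f i q| <= M%:Z.
  have [|z [zM]] := MP 0%N (f i) _ x q; last first.
    by rewrite dvd0z => /eqP e; rewrite -[X in `|X|](subrK z) e add0r.
  move=> s sS {}q; exists (f i (ray_act q s) - f i q); rewrite subrr dvdz0; split=> //.
  have [] := gray_gen (mkseq q (n_ i).+3) sS; rewrite /f ray_act_prefix.
  by move: (3 * _)%N (gray _) (gray _) => k a b; lia.
have f_short i q e : (size e <= L)%N -> `|f i (run (@word_act _ X) q e) - f i q| <= (M * L)%N%:Z.
  move=> eL; apply: le_trans (lipschitz_run q e (f_letter i)) _.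
  by rewrite lez_nat leq_mul2l eL orbT.
have fU i U1 U2 : U i = U1 ++ U2 -> f i (run (@ray_act _) eta U1) = - (size U2)%:Z.
  by have [_ _ _ UP _] := UW i; move=> /UP; rewrite /f; move: (gray _) (3 * _)%N => a b; lia.
have fW i W1 W2 : W i = W1 ++ W2 -> 0 <= f i (run (@ray_act _) eta (U i ++ W1)).
  by have [_ _ _ _ WP] := UW i; move=> /WP; rewrite /f; move: (gray _) (3 * _)%N => a b; lia.
have fV i V1 V2 : V i = V1 ++ V2 -> 0 <= f i (run (@ray_act _) eta (U i ++ V1)).
  rewrite /V => /cat_eq_cat[[c [-> E]]|[c [E _]]]; last exact: fW E.
  rewrite catA run_cat; case: c E => [|s c] /= E.
    by apply: (fW _ _ [::]); rewrite cats0.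
  case: E => <- E; rewrite l_fix run_cat (retrace _ _ _ _ _ E) // -run_cat.
  by apply: (fW _ _ (rev c)); rewrite -rev_cat -E revK.
have scale (y : int) (k : nat) : `|y - - k%:Z| <= (M * L)%N%:Z ->
    (L * k.+1)%N%:Z <= C%:Z * (C%:Z - y).
  move=> hy; rewrite [X in X <= _]PoszM /C.
  by apply: ler_pM => //; move: (M * L)%N hy => a; lia.
have := context_free_interchange (@word_act_inj _ X) (u := u) (v := v) (t := t)
  (f := f) (M := M) (C := C) CF.
case.
- move=> i; rewrite /loops /= !run_cat !run_sp ?V_loop ?run_rev //; exact: revS.
- exact: f_letter.
- move=> i v1 v2 /(spelling_eq_cat spellP (VS i))[V1 [V2 [e [VE -> eL _ _]]]].
  rewrite catA run_cat -spelling_cat run_sp; last first.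
    by apply: catS => //; apply: cat_subl VE.
  have := f_short i (run (@ray_act _) eta (U i ++ V1)) e eL; have := fV i _ _ VE.
  by rewrite /C; move: (f i _) (f i _) (M * L)%N => a b c; lia.
- move=> i u1 u2 /(spelling_eq_cat spellP (US i))[U1 [U2 [e [UE -> eL _ su2]]]].
  rewrite run_cat run_sp; last exact: cat_subl UE.
  have := f_short i (run (@ray_act _) eta U1) e eL; rewrite (fU i _ _ UE).
  by move/scale; apply: le_trans; rewrite lez_nat mulnS;
    exact: leq_trans su2 (leq_addl _ _).
- move=> i t1 t2 /(spelling_eq_cat spellP (revS _ (US i)))[U1 [U2 [e [UE -> eL st1 _]]]].
  rewrite !run_cat !run_sp //; last by apply: cat_subl UE; apply: revS.
  rewrite V_loop (retrace _ _ _ _ _ UE) //.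
  have UE' : U i = rev U2 ++ rev U1 by rewrite -rev_cat -UE revK.
  have := f_short i (run (@ray_act _) eta (rev U2)) e eL.
  rewrite (fU i _ _ UE') size_rev => /scale; apply: le_trans; by rewrite lez_nat.
move=> i [j [ij]]; rewrite /loops /= !run_cat !run_sp //; last exact: revS.
have actI s : injective ((@ray_act 'I_2)^~ s) by apply: can_inj (ray_actK s).
set p := run _ eta (U j) => lp.
have {}lp : run (@ray_act _) p (V i) = p.
  by apply: (run_inj (w := rev (U j)) actI); rewrite /= lp run_rev.
set y := run (@ray_act _) p (W i).
have yl : ray_act y (l i) = y.
  apply: (run_inj (w := rev (W i)) actI); rewrite /= run_rev //.
  by rewrite -[RHS]lp /V run_cat.
pose g := (\prod_(s <- W i) s)%g.
have gE q : run (@ray_act _) q (W i) = ray_act q g.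
  rewrite /g; elim: (W i) q => [|s Y IHY] q; first by rewrite big_nil ray_act1.
  by rewrite big_cons ray_actM -IHY.
have [_ _ [pi qi] _ _] := UW i; have [_ _ [pj _] _ _] := UW j.
have nij := n_incr _ _ ij; set n := n_ i in pi qi nij.
have n13 : (n.+1 <= n.+3)%N by lia.
(* The effect of [W i] at its own vertex shows that [g] fixes 1...1 of length [n] and exchanges its
   two children. *)
have g0 : g (rcons (nseq n 1) 0) = rcons (nseq n 1) 1.
  have <- : mkseq (run (@ray_act _) eta (U i)) n.+1 = rcons (nseq n 1) 0.
    rewrite (take_mkseq _ n13) pi -cats1 -[[:: 0; 1; 0]]/([:: 0] ++ [:: 1; 0]) catA.
    by rewrite take_size_cat // size_cat size_nseq addn1.
  rewrite -ray_act_prefix -gE -run_cat (take_mkseq _ n13) qi.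
  rewrite -cats1 -[[:: 1]]/(nseq 1 1) -nseqD addn1 -[n.+2]addn1 nseqD -catA.
  by rewrite take_size_cat // size_nseq.
have pn m : (m <= n.+1)%N -> mkseq p m = nseq m 1.
  move=> mn; have mj : (m <= n_ j)%N := leq_trans mn nij.
  rewrite (take_mkseq _ (leq_trans mj (leq_addr 3 _))) addn3 pj takel_cat ?size_nseq //.
  exact: take_nseq.
have yp m : mkseq y m = g (mkseq p m) by rewrite /y gE ray_act_prefix.
have gn : g (nseq n 1) = nseq n 1.
  have [x] := aut_child g (nseq n 1) 0.
  by rewrite g0 => /rcons_inj[].
(* As [i < j], the prefix of [p] of length [n + 1] is 1...1, which [g] cannot send where it sends
   1...10. *)
have yn : y n = 0.
  case: (ord2_cases (y n)) => // y1; have := yp n.+1.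
  rewrite mkseqS y1 yp !pn // gn -[RHS]/(g (1 :: nseq n 1)) -g0.
  move/(can_inj (aut_funK g))/(congr1 (nth 0 ^~ n)).
  by rewrite nth_rcons size_nseq ltnn eqxx -[_ :: _]/(nseq n.+1 1) nth_nseq ltnSn.
(* Below the first [n] letters 1, [l i] acts as [fixer 2], which is [grig_b]; it changes the letter
   after the 0, so it does not fix [y]. *)
have := ray_act_prefix y (l i) n.+2; rewrite yl !mkseqS yn yp pn // gn -!cats1 -catA.
rewrite /l -/n -[n.+2]/(2 + n)%N fixer_ones => /(congr1 (drop n)).
rewrite !drop_size_cat ?size_nseq //.
by case: (ord2_cases (y n.+1)) => ->.
Qed.

End Grigorchuk.

Theorem mainTheorem6 :
  (forall (X : {fset tree_aut 'I_2}) (eta : nat -> 'I_2),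
     symmetric_generating_set grigorchuk_group X ->
     ~ context_free (WP X (Stab grigorchuk_group eta))) /\
  (forall (X : {fset tree_aut 'I_3}) (eta : nat -> 'I_3),
     symmetric_generating_set hanoi_group X ->
     ~ context_free (WP X (Stab hanoi_group eta))) /\
  (forall (X : {fset tree_aut 'I_2}) (eta : nat -> 'I_2),
     symmetric_generating_set basilica_group X ->
     ~ context_free (WP X (Stab basilica_group eta))).
Proof.
split; [|split] => X eta.
- exact: grigorchuk_not_context_free.
- exact: hanoi_not_context_free.
- exact: basilica_not_context_free.
Qed.
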